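(* Let $C=(C^n,d^n,[-,-])$ be a dg-Lie algebra, $B=(B^n,\delta^n)$ a cochain complex, $G^*:B\to C$ and $F^*:C\to B$ morphisms of complexes, and $H^*:C\to C$ a map of degree $-1$ such that $F^*G^*=\mathrm{Id}$, $G^*F^*-\mathrm{Id}=H^*d+dH^*$ and $F^*H^*=0$. Let $l_n:\otimes^nB\to B$ and $\phi_n:\otimes^nB\to C$ ($n\ge 1$) be the maps defined recursively from these data as in the context. Then the maps $l_n$, $n\in\mathbb N$, give $B$ an $L_\infty$-structure. Moreover, this structure extends $G^*$ to a weak $L_\infty$-morphism $\phi=(\phi_n)_{n\ge1}:B\to C$ (with $\phi_1=G^*$).
   Context: $\Bbbk$ is a field of characteristic zero, $\otimes=\otimes_{\Bbbk}$. In a dg-Lie algebra the differential has degree $1$, the bracket has degree $0$, is graded antisymmetric, satisfies the graded Jacobi identity, and $d[x,y]=[dx,y]+(-1)^{|x|}[x,dy]$. Signs. For homogeneous $v_1,\dots,v_n$ in a graded space and $\sigma\in\mathbb S_n$, the Koszul sign $\varepsilon(\sigma)$ is defined by $v_1\wedge\dots\wedge v_n=\varepsilon(\sigma)v_{\sigma(1)}\wedge\dots\wedge v_{\sigma(n)}$ in the free graded commutative algebra; $\chi(\sigma)=\operatorname{sgn}(\sigma)\varepsilon(\sigma)$; and for $1\le t<n$, $\kappa(\sigma)_t=(-1)^{(t-1)+(n-t-1)\sum_{p=1}^t|v_{\sigma(p)}|}$. Put $\hat\sigma(v_1\otimes\dots\otimes v_n)=v_{\sigma(1)}\otimes\dots\otimes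 v_{\sigma(n)}$. $\mathbb S_{t,n-t}$ is the set of $\sigma\in\mathbb S_n$ with $\sigma(1)<\dots<\sigma(t)$ and $\sigma(t+1)<\dots<\sigma(n)$; $\mathbb S^-_{t,n-t}$ is the subset of those with $\sigma(1)<\sigma(t+1)$. An $L_\infty$-algebra is a $\mathbb Z$-graded vector space $L$ with linear maps $l_n:\otimes^nL\to L$ of degree $2-n$ such that for all $n\ge1$, on homogeneous elements, $l_n\hat\sigma=\chi(\sigma)l_n$ for all $\sigma\in\mathbb S_n$, and $$\sum_{i+j=n+1}\sum_{\sigma\in\mathbb S_{i,n-i}}(-1)^{i(j-1)}\chi(\sigma)\,l_j(l_i\otimes\mathrm{Id}^{\otimes n-i})\hat\sigma=0.$$ A weak $L_\infty$-morphism from an $L_\infty$-algebra $(L,l_n)$ to a dg-Lie algebra $(C,d,[-,-])$ is a collection of skew symmetric linear maps $\phi_n:\otimes^nL\to C$ of degree $1-n$ (skew symmetric: $\phi_n\hat\sigma=\chi(\sigma)\phi_n$) such that for all $n\geq 1$ and homogeneous elements $$d\phi_n+\sum_{j+k=n+1}\sum_{\sigma\in\mathbb S_{k,n-k}}\chi(\sigma)(-1)^{k(j-1)+1}\phi_j(l_k\otimes\mathrm{Id}^{\otimes n-k})\hat\sigma+\sum_{s+t=n}\sum_{\tau\in\mathbb S^-_{s,n-s}}\chi(\tau)\kappa(\tau)_s[\phi_s,\phi_t]\hat\tau=0,$$ where $[\phi_s,\phi_t](v_1\otimes\dots\otimes v_n)=[\phi_s(v_1\otimes\dots\otimes v_s),\phi_t(v_{s+1}\otimes\dots\otimes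 v_n)]$. Recursive definition. $l_n:\otimes^nB\to B$ and $u_n,v_n:\otimes^nB\to C$ have degree $2-n$, $\phi_n:\otimes^nB\to C$ has degree $1-n$; $l_1=\delta^*$, $u_1=v_1=0$, $\phi_1=G^*$; and for $n>1$, on homogeneous elements, $$v_n=\sum_{t=1}^{n-1}\sum_{\tau\in\mathbb S^-_{t,n-t}}\chi(\tau)\kappa(\tau)_t[\phi_t,\phi_{n-t}]\hat\tau,\qquad l_n=F^*v_n,$$ $$u_n=\sum_{k=2}^n\sum_{\tau\in\mathbb S_{k,n-k}}(-1)^{k(n-k)+1}\chi(\tau)\,\phi_{n-k+1}(l_k\otimes\mathrm{Id}^{\otimes n-k})\hat\tau,\qquad \phi_n=H^*(u_n+v_n).$$ *)

(* Defs.v *)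
From HB Require Import structures.
From mathcomp Require Import all_boot all_fingroup all_algebra.

Set Implicit Arguments.
Unset Strict Implicit.
Unset Printing Implicit Defensive.

Import GRing.Theory.
Local Open Scope ring_scope.

(* A Z-graded vector space is a vector space V together with subspaces V^p
   (p : int) of which it is the internal direct sum. *)
Record gradedSpace (k : fieldType) := GradedSpace {
  gsort :> lmodType k;
  gpart : int -> gsort -> Prop;
  gpart0 : forall p, gpart p 0;
  gpartP : forall p (a : k) x y,
    gpart p x -> gpart p y -> gpart p (a *: x + y);
  gpart_span : forall x, exists (s : seq int) (c : int -> gsort),
    [/\ uniq s, forall p, gpart p (c p) & x = \sum_(p <- s) c p];
  gpart_free : forall (s : seq int) (c : int -> gsort),
    uniq s -> (forall p, gpart p (c p)) -> \sum_(p <- s) c p = 0 ->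
    forall p, p \in s -> c p = 0
}.

Definition map_degree (k : fieldType) (V W : gradedSpace k) (e : int)
    (f : V -> W) : Prop :=
  forall p x, gpart p x -> gpart (p + e) (f x).

Record cochainComplex (k : fieldType) := CochainComplex {
  csort :> gradedSpace k;
  cdiff : {linear csort -> csort};
  cdiff_deg : map_degree 1 cdiff;
  cdiffK : forall x, cdiff (cdiff x) = 0
}.

Record dgLie (k : fieldType) := DgLie {
  dgsort :> cochainComplex k;
  bracket : dgsort -> dgsort -> dgsort;
  bracket_linl : forall y, linear (bracket^~ y);
  bracket_linr : forall x, linear (bracket x);
  bracket_deg : forall p q x y,
    gpart p x -> gpart q y -> gpart (p + q) (bracket x y);
  bracket_anti : forall p q x y, gpart p x -> gpart q y ->
    bracket x y = - ((-1) ^ (p * q) *: bracket y x);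
  bracket_jacobi : forall p q r x y z,
    gpart p x -> gpart q y -> gpart r z ->
    bracket x (bracket y z) =
      bracket (bracket x y) z + (-1) ^ (p * q) *: bracket y (bracket x z);
  bracket_leibniz : forall p q x y, gpart p x -> gpart q y ->
    cdiff dgsort (bracket x y) =
      bracket (cdiff dgsort x) y + (-1) ^ p *: bracket x (cdiff dgsort y)
}.

Section Signs.
Variables (k : fieldType) (n : nat) (d : n.-tuple int).

(* d lists the degrees of v_1, ..., v_n. Passing from v_1 ... v_n to
   v_(sigma 1) ... v_(sigma n) in the free graded commutative algebra
   interchanges exactly the pairs inverted by sigma, each such interchange
   contributing (-1)^(|v||w|). *)
Definition koszul (sigma : 'S_n) : k :=
  \prod_(i < n) \prod_(j < n | (i < j)%N && (sigma j < sigma i)%N)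
    (-1) ^ (tnth d (sigma i) * tnth d (sigma j)).

Definition chi (sigma : 'S_n) : k := (-1) ^+ sigma * koszul sigma.

Definition kappa (sigma : 'S_n) (t : nat) : k :=
  (-1) ^ ((t%:Z - 1) +
          (n%:Z - t%:Z - 1) * \sum_(p < n | (p < t)%N) tnth d (sigma p)).

End Signs.

(* S_(t,n-t): positions are numbered from 0, so that the first block is
   {0, ..., t-1} and the second one {t, ..., n-1}. *)
Definition unshuffle (n t : nat) (sigma : 'S_n) : bool :=
  [forall i : 'I_n, forall j : 'I_n,
    [&& (i < j)%N & (j < t)%N || (t <= i)%N] ==> (sigma i < sigma j)%N].

(* S^-_(t,n-t), for 0 < t < n. *)
Definition unshuffle_minus (n t : nat) (sigma : 'S_n) : bool :=
  unshuffle t sigma &&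
  [forall i : 'I_n, forall j : 'I_n,
    [&& i == 0%N :> nat & j == t :> nat] ==> (sigma i < sigma j)%N].

Definition permute (T : Type) (n : nat) (sigma : 'S_n) (x : n.-tuple T) :
    n.-tuple T :=
  [tuple tnth x (sigma i) | i < n].

Section Operations.
Variables (k : fieldType) (V W : gradedSpace k).

(* As seq V is the disjoint union of the V^n, a function f : seq V -> W is a
   family of functions f_n : V^n -> W, where f_n is f on sequences of length
   n; it is a family of linear maps on the tensor powers of V when it is
   multilinear. Its value at the empty sequence is never used. *)
Definition multilinear (f : seq V -> W) : Prop :=
  forall s1 s2 : seq V, linear (fun x : V => f (s1 ++ x :: s2)).

Definition homogeneous (n : nat) (d : n.-tuple int) (x : n.-tuple V) : Prop :=
  forall i, gpart (tnth d i) (tnth x i).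

Definition op_degree (e : nat -> int) (f : seq V -> W) : Prop :=
  forall n (d : n.-tuple int) (x : n.-tuple V), (0 < n)%N ->
  homogeneous d x -> gpart (\sum_(i < n) tnth d i + e n) (f x).

Definition skew_symmetric (f : seq V -> W) : Prop :=
  forall n (d : n.-tuple int) (x : n.-tuple V), (0 < n)%N ->
  homogeneous d x -> forall sigma : 'S_n,
  f (permute sigma x) = chi k d sigma *: f x.

End Operations.

(* f_j (g_i (x) Id^(n-i)) on a sequence of length n, with j = n - i + 1 *)
Definition insert_op (k : fieldType) (V W : gradedSpace k)
    (f : seq V -> W) (g : seq V -> V) (i : nat) (x : seq V) : W :=
  f (g (take i x) :: drop i x).

Definition bracket_op (k : fieldType) (V : gradedSpace k) (C : dgLie k)
    (f : seq V -> C) (t : nat) (x : seq V) : C :=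
  bracket (f (take t x)) (f (drop t x)).

Record is_Linfty (k : fieldType) (L : gradedSpace k) (l : seq L -> L) : Prop :=
{
  Linfty_linear : multilinear l;
  Linfty_degree : op_degree (fun n => 2 - n%:Z) l;
  Linfty_skew : skew_symmetric l;
  Linfty_jacobi : forall n (d : n.-tuple int) (x : n.-tuple L), (0 < n)%N ->
    homogeneous d x ->
    \sum_(1 <= i < n.+1) \sum_(sigma : 'S_n | unshuffle i sigma)
      (let j := (n.+1 - i)%N in
       ((-1) ^+ (i * (j - 1)) * chi k d sigma) *:
         insert_op l l i (permute sigma x)) = 0
}.

Record is_weak_morphism (k : fieldType) (L : gradedSpace k) (l : seq L -> L)
    (C : dgLie k) (phi : seq L -> C) : Prop :=
{
  weak_linear : multilinear phi;
  weak_degree : op_degree (fun n => 1 - n%:Z) phi;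
  weak_skew : skew_symmetric phi;
  weak_eq : forall n (d : n.-tuple int) (x : n.-tuple L), (0 < n)%N ->
    homogeneous d x ->
    cdiff C (phi x)
    + \sum_(1 <= i < n.+1) \sum_(sigma : 'S_n | unshuffle i sigma)
        (let j := (n.+1 - i)%N in
         (chi k d sigma * (-1) ^+ (i * (j - 1) + 1)) *:
           insert_op phi l i (permute sigma x))
    + \sum_(1 <= s < n) \sum_(tau : 'S_n | unshuffle_minus s tau)
        (chi k d tau * kappa k d tau s) *: bracket_op phi s (permute tau x)
    = 0
}.

(* These conditions determine l, u, v and phi on nonempty sequences, by
   induction on the length. *)
Record is_transfer (k : fieldType) (C : dgLie k) (B : cochainComplex k)
    (F : C -> B) (G : B -> C) (H : C -> C)
    (l : seq B -> B) (u v phi : seq B -> C) : Prop :=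
{
  transfer_linear :
    [/\ multilinear l, multilinear u, multilinear v & multilinear phi];
  transfer_degree :
    [/\ op_degree (fun n => 2 - n%:Z) l, op_degree (fun n => 2 - n%:Z) u,
        op_degree (fun n => 2 - n%:Z) v & op_degree (fun n => 1 - n%:Z) phi];
  transfer_1 : forall x : B,
    [/\ l [:: x] = cdiff B x, u [:: x] = 0, v [:: x] = 0 & phi [:: x] = G x];
  transfer_rec : forall n (d : n.-tuple int) (x : n.-tuple B), (1 < n)%N ->
    homogeneous d x ->
    [/\ v x = \sum_(1 <= t < n) \sum_(tau : 'S_n | unshuffle_minus t tau)
                (chi k d tau * kappa k d tau t) *:
                  bracket_op phi t (permute tau x),
        l x = F (v x),
        u x = \sum_(2 <= i < n.+1) \sum_(tau : 'S_n | unshuffle i tau)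
                ((-1) ^+ (i * (n - i) + 1) * chi k d tau) *:
                  insert_op phi l i (permute tau x)
      & phi x = H (u x + v x)]
}.

(* Main.v *)
Require Import Defs.
From HB Require Import structures.
From mathcomp Require Import all_boot all_fingroup all_algebra.
From mathcomp Require Import ssrAC zify.
From Stdlib Require Import IndefiniteDescription.
Set Implicit Arguments.
Unset Strict Implicit.
Unset Printing Implicit Defensive.
Import GRing.Theory.
Local Open Scope ring_scope.

(** A family of skew symmetric operations [f_n : B^n -> C] is a linear map on the
    exterior coalgebra of [B]. Such maps form a dg-Lie algebra under the
    convolution bracket [cup], and a family [l] on [B] acts on them through the
    coderivation [Q] that it induces, by [insert]. In this language
    [half_cup phi] is [[phi, phi] / 2], the weak morphism equation says that the
    Maurer-Cartan defect [E = d phi - phi Q + [phi, phi] / 2] vanishes, and the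
    generalized Jacobi identities say that [J = l Q] vanishes.

    Let [Q1] and [Q2] be the parts of [Q] coming from [l_1] and from the [l_n]
    with [n > 1], and let [W = [phi, phi] / 2 - phi Q2], which is [v + u]. The
    recursion reads [phi = G + H W] and [l = F [phi, phi] / 2] in arity at
    least 2. Since [F G = 1] and [F H = 0], the map [F phi Q2] is [l] in these
    arities, whence [F W = 0] ([F_source]). The homotopy identity then turns
    the definition of [E] into [E = - H (d W + W Q1)] ([mc_defect_source]).

    By induction on the arity [n], assume that [E] and [J] vanish below [n].
    The Leibniz rules ([cdiff_cup], [insert_cup]) and the Jacobi identity
    ([cup_jacobi]) give [d [phi, phi] = - [phi, phi] Q], and replacing [d phi]
    by [phi Q - [phi, phi] / 2] in [d W + W Q1] leaves [- phi Q Q]. As [Q] is an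
    odd coderivation, [Q Q] is the coderivation induced by [J]
    ([insert_insert]), so that only [- G J_n] remains in arity [n]. Applying [F]
    kills [d W + W Q1] and yields [J_n = 0], then [E_n = 0]
    ([mc_relations]).

    To make the coalgebra computations elementary, sums over unshuffles are
    rewritten as a recursion on words of vectors with declared degrees
    ([unshuffle_sum]): coassociativity, cocommutativity and the behaviour under
    the exchange of two letters are inductions on words, and every identity of
    signs is decided by cases on the parities of degrees and lengths.
    The comparison with permutations ([sum_unshuffle]) removes the first letter
    from a permutation; skew symmetry, proved on words for adjacent letters,
    extends to all permutations in the same way ([skew_of_swaps]).

    Solutions of the recursion exist because, on words with declared degrees, it
    only involves shorter words ([raw_morphism]) and is multilinear; the
    operations on arbitrary vectors are obtained by splitting every vector into
    its even and odd parts, as signs depend on parities only ([extend]). *)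

(** * Parities and signs *)

Definition oddz (m : int) : bool := odd `|m|%N.

Lemma oddzD m n : oddz (m + n) = oddz m (+) oddz n.
Proof.
have oddN (p : int) : oddz (- p) = oddz p by rewrite /oddz abszN.
have oddB (p q : nat) : oddz (p%:Z - q%:Z) = odd p (+) odd q.
  case: (leqP q p) => [le_qp | lt_pq].
    by rewrite subzn // /oddz absz_nat oddB.
  by rewrite -oddN opprB subzn 1?ltnW // /oddz absz_nat oddB 1?ltnW // addbC.
case: m n => [m | m] [n | n]; rewrite ?NegzE.
- by rewrite -PoszD /oddz !absz_nat oddD.
- by rewrite oddB oddN.
- by rewrite addrC oddB oddN addbC.
- by rewrite -opprD !oddN -PoszD /oddz !absz_nat oddD.
Qed.

Lemma oddzN m : oddz (- m) = oddz m.
Proof. by rewrite /oddz abszN. Qed.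

Lemma oddzM m n : oddz (m * n) = oddz m && oddz n.
Proof. by rewrite /oddz abszM oddM. Qed.

Lemma oddz_nat (n : nat) : oddz n%:Z = odd n.
Proof. by []. Qed.

Lemma exprN1z (k : fieldType) (m : int) : (-1 : k) ^ m = (-1) ^+ oddz m.
Proof.
case: m => m; first by rewrite /oddz absz_nat signr_odd.
rewrite NegzE -exprnN /oddz abszN absz_nat signr_odd.
by rewrite -exprVn invrN invr1.
Qed.

Definition signed (V : zmodType) (b : bool) (v : V) : V := if b then - v else v.

Section Signed.
Variable V : zmodType.
Implicit Types (b c : bool) (u v : V).

Lemma signedD b u v : signed b (u + v) = signed b u + signed b v.
Proof. by case: b; rewrite //= opprD. Qed.

Lemma signedN b v : signed b (- v) = - signed b v.
Proof. by case: b. Qed.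

Lemma signed0 b : signed b (0 : V) = 0.
Proof. by case: b; rewrite //= oppr0. Qed.

Lemma signedK b c v : signed b (signed c v) = signed (b (+) c) v.
Proof. by case: b; case: c; rewrite //= opprK. Qed.

Lemma signed_morph (U : zmodType) (f : V -> U) :
  (forall u v, f (u + v) = f u + f v) ->
  forall b v, f (signed b v) = signed b (f v).
Proof.
move=> fD; have f0 : f 0 = 0 by apply: (addrI (f 0)); rewrite -fD !addr0.
by case=> //= v; apply: (addrI (f v)); rewrite -fD !subrr f0.
Qed.

End Signed.

Lemma signedE (k : fieldType) (V : lmodType k) b (v : V) :
  signed b v = (-1) ^+ b *: v.
Proof. by case: b; rewrite ?scaleN1r ?scale1r. Qed.

(** Instances of [raddfD] and its companions that mention [g] as a linear map,
    so that lemmas about linear maps still apply after rewriting. *)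
Lemma lin_morphD (k : fieldType) (U V : lmodType k) (g : {linear U -> V}) u v :
  g (u + v) = g u + g v.
Proof. exact: raddfD. Qed.

Lemma lin_morphB (k : fieldType) (U V : lmodType k) (g : {linear U -> V}) u v :
  g (u - v) = g u - g v.
Proof. exact: raddfB. Qed.

Lemma lin_morphN (k : fieldType) (U V : lmodType k) (g : {linear U -> V}) u :
  g (- u) = - g u.
Proof. exact: raddfN. Qed.

Lemma lin_morph0 (k : fieldType) (U V : lmodType k) (g : {linear U -> V}) :
  g 0 = 0.
Proof. exact: raddf0. Qed.

(** * Unshuffles of words *)

Section Words.
Variables (T : Type) (deg : T -> int).
Implicit Types (a b s : seq T) (x y : T).

Definition wdeg a : int := \sum_(x <- a) deg x.
Definition wpar a : bool := oddz (wdeg a).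

Lemma wdeg_cons x a : wdeg (x :: a) = deg x + wdeg a.
Proof. by rewrite /wdeg big_cons. Qed.

Lemma wdeg_cat a b : wdeg (a ++ b) = wdeg a + wdeg b.
Proof. by rewrite /wdeg big_cat. Qed.

Lemma wpar_nil : wpar [::] = false.
Proof. by rewrite /wpar /wdeg big_nil. Qed.

Lemma wpar_cons x a : wpar (x :: a) = oddz (deg x) (+) wpar a.
Proof. by rewrite /wpar wdeg_cons oddzD. Qed.

Lemma wpar_cat a b : wpar (a ++ b) = wpar a (+) wpar b.
Proof. by rewrite /wpar wdeg_cat oddzD. Qed.

(** The sign [chi] of the permutation exchanging two adjacent blocks. *)
Definition swap_sign a b : bool :=
  (wpar a && wpar b) (+) (odd (size a) && odd (size b)).

(** The pairs over which [unshuffle_sum] runs: what is summed may be rewritten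
    using that [a] and [b] are complementary in [s]. *)
Fixpoint unshuffled s a b : Prop :=
  if s is x :: s' then
    (exists2 a', a = x :: a' & unshuffled s' a' b) \/
    (exists2 b', b = x :: b' & unshuffled s' a b')
  else a = [::] /\ b = [::].

Lemma unshuffled_size s a b : unshuffled s a b -> size s = (size a + size b)%N.
Proof.
elim: s a b => [|x s IHs] a b /=; first by case=> -> ->.
by case=> [[a' -> /IHs ->] | [b' -> /IHs ->]] //=; rewrite addnS.
Qed.

Lemma unshuffled_wdeg s a b : unshuffled s a b -> wdeg s = wdeg a + wdeg b.
Proof.
elim: s a b => [|x s IHs] a b /=; first by case=> -> ->; rewrite /wdeg big_nil.
case=> [[a' -> /IHs] | [b' -> /IHs]]; rewrite !wdeg_cons => ->.
  by rewrite addrA.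
by rewrite addrCA.
Qed.

Lemma unshuffled_wpar s a b : unshuffled s a b -> wpar s = wpar a (+) wpar b.
Proof. by move/unshuffled_wdeg => e; rewrite /wpar e oddzD. Qed.

Lemma unshuffledC s a b :
  unshuffled s a b -> unshuffled s b a.
Proof.
elim: s a b => [|x s IHs] a b /=; first by case=> -> ->.
by case=> [[a' -> /IHs] | [b' -> /IHs]]; [right; exists a' | left; exists b'].
Qed.

Section Sum.
Variable V : zmodType.
Implicit Type F : seq T -> seq T -> V.

(** Sum over all unshuffles of [s] into a pair of subwords, with the sign [chi]
    of each unshuffle; it is a value of the coproduct of the exterior
    coalgebra. The first letter goes to the second block at the price of jumping
    over the whole first block. *)
Fixpoint unshuffle_sum s F : V :=
  if s is x :: s' then
    unshuffle_sum s' (fun a b => F (x :: a) b) +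
    unshuffle_sum s' (fun a b => signed (swap_sign [:: x] a) (F a (x :: b)))
  else F [::] [::].

Lemma eq_unshuffle_sum s F1 F2 :
  (forall a b, unshuffled s a b -> F1 a b = F2 a b) ->
  unshuffle_sum s F1 = unshuffle_sum s F2.
Proof.
elim: s F1 F2 => [|x s IHs] F1 F2 eqF /=; first exact: eqF.
congr (_ + _); apply: IHs => a b sp; rewrite eqF //=.
  by left; exists a.
by right; exists b.
Qed.

Lemma unshuffle_sumD s F1 F2 :
  unshuffle_sum s (fun a b => F1 a b + F2 a b) =
  unshuffle_sum s F1 + unshuffle_sum s F2.
Proof.
elim: s F1 F2 => [|x s IHs] F1 F2 //=; rewrite IHs addrACA; congr (_ + _).
by rewrite -IHs; apply: eq_unshuffle_sum => a b _; rewrite signedD.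
Qed.

Lemma unshuffle_sum0 s F :
  (forall a b, unshuffled s a b -> F a b = 0) -> unshuffle_sum s F = 0.
Proof.
elim: s F => [|x s IHs] F F0 /=; first exact: F0.
rewrite !IHs ?addr0 // => a b sp; rewrite F0 ?signed0 //=.
  by right; exists b.
by left; exists a.
Qed.

Lemma unshuffle_sum_signed s c F :
  signed c (unshuffle_sum s F) =
  unshuffle_sum s (fun a b => signed c (F a b)).
Proof.
elim: s F => [|x s IHs] F //=; rewrite signedD !IHs; congr (_ + _).
by apply: eq_unshuffle_sum => a b _; rewrite !signedK addbC.
Qed.

Lemma unshuffle_sumN s F :
  - unshuffle_sum s F = unshuffle_sum s (fun a b => - F a b).
Proof. exact: (unshuffle_sum_signed s true). Qed.

(** Coassociativity: both sides run over the threefold unshuffles, and the sign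
    for jumping over a word is multiplicative in that word. *)
Lemma unshuffle_sumA s (F : seq T -> seq T -> seq T -> V) :
  unshuffle_sum s (fun a b => unshuffle_sum b (fun c e => F a c e)) =
  unshuffle_sum s (fun p e => unshuffle_sum p (fun a c => F a c e)).
Proof.
elim: s F => [|x s IHs] F //=.
rewrite (IHs (fun a c e => F (x :: a) c e)) unshuffle_sumD -!addrA.
congr (_ + _).
under [in LHS]eq_unshuffle_sum => a b _ do
  rewrite signedD !unshuffle_sum_signed.
rewrite unshuffle_sumD.
rewrite (IHs (fun a c e => signed (swap_sign [:: x] a) (F a (x :: c) e))).
rewrite (IHs (fun a c e => signed (swap_sign [:: x] a)
                  (signed (swap_sign [:: x] c) (F a c (x :: e))))).
congr (_ + _); apply: eq_unshuffle_sum => p e _.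
rewrite unshuffle_sum_signed; apply: eq_unshuffle_sum => a c sp.
rewrite signedK /swap_sign (unshuffled_wpar sp) (unshuffled_size sp) oddD /=.
by rewrite !andb_addr addbACA.
Qed.

(** Graded cocommutativity of the exterior coalgebra. *)
Lemma unshuffle_sumC s F :
  unshuffle_sum s F =
  unshuffle_sum s (fun a b => signed (swap_sign a b) (F b a)).
Proof.
elim: s F => [|x s IHs] F /=; first by rewrite /swap_sign !wpar_nil.
rewrite addrC [X in X + _]IHs [X in _ + X]IHs; congr (_ + _).
  apply: eq_unshuffle_sum => a b _; rewrite signedK; congr signed.
  rewrite /swap_sign !wpar_cons wpar_nil /=.
  by do 2!case: (odd (size _)); do 2!case: (wpar _); case: (oddz _).
apply: eq_unshuffle_sum => a b _; rewrite signedK; congr signed.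
rewrite /swap_sign !wpar_cons wpar_nil /=.
by do 2!case: (odd (size _)); do 2!case: (wpar _); case: (oddz _).
Qed.

(** In a threefold unshuffle the first two blocks can be exchanged. *)
Lemma unshuffle_sumCA s (F : seq T -> seq T -> seq T -> V) :
  unshuffle_sum s (fun a b => unshuffle_sum b (fun c e => F a c e)) =
  unshuffle_sum s (fun a b => unshuffle_sum b (fun c e =>
    signed (swap_sign a c) (F c a e))).
Proof.
rewrite unshuffle_sumA (unshuffle_sumA _ (fun a c e => signed _ (F c a e))).
by apply: eq_unshuffle_sum => p e _; rewrite unshuffle_sumC.
Qed.

(** Compatibility of the coproduct with concatenation. *)
Lemma unshuffle_sum_cat s1 s2 F :
  unshuffle_sum (s1 ++ s2) F =
  unshuffle_sum s1 (fun a1 b1 => unshuffle_sum s2 (fun a2 b2 =>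
    signed (swap_sign b1 a2) (F (a1 ++ a2) (b1 ++ b2)))).
Proof.
elim: s1 F => [|x s1 IHs] F /=.
  by apply: eq_unshuffle_sum => a b _; rewrite /swap_sign wpar_nil.
rewrite !IHs; congr (_ + _); apply: eq_unshuffle_sum => a1 b1 _.
rewrite unshuffle_sum_signed; apply: eq_unshuffle_sum => a2 b2 _.
rewrite !signedK; congr signed.
rewrite /swap_sign !wpar_cons wpar_nil wpar_cat size_cat oddD /=.
by do 3!case: (odd (size _)); do 3!case: (wpar _); case: (oddz _).
Qed.

Lemma unshuffle_sum_nilr s (f : seq T -> V) :
  unshuffle_sum s (fun a b => if b is [::] then f a else 0) = f s.
Proof.
elim: s f => [|x s IHs] f //=; rewrite IHs unshuffle_sum0 ?addr0 // => a b _.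
exact: signed0.
Qed.

(** How the sum over the unshuffles of a word changes when two adjacent letters
    are exchanged: the unshuffles separating the two letters are matched with
    each other, the others contribute through the symmetry of [F]. *)
Lemma unshuffle_sum_swap s1 x y s2 F :
  (forall a1 a2 b, unshuffled (s1 ++ s2) (a1 ++ a2) b ->
     F (a1 ++ x :: y :: a2) b =
     signed (swap_sign [:: x] [:: y]) (F (a1 ++ y :: x :: a2) b)) ->
  (forall a b1 b2, unshuffled (s1 ++ s2) a (b1 ++ b2) ->
     F a (b1 ++ x :: y :: b2) =
     signed (swap_sign [:: x] [:: y]) (F a (b1 ++ y :: x :: b2))) ->
  unshuffle_sum (s1 ++ x :: y :: s2) F =
  signed (swap_sign [:: x] [:: y]) (unshuffle_sum (s1 ++ y :: x :: s2) F).
Proof.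
have unshuffled_cat a1 b1 a2 b2 : unshuffled s1 a1 b1 -> unshuffled s2 a2 b2 ->
    unshuffled (s1 ++ s2) (a1 ++ a2) (b1 ++ b2).
  elim: s1 a1 b1 => [|z s IHs] a1 b1 /=; first by case=> -> ->.
  case=> [[a' -> sp] | [b' -> sp]] sp2.
    by left; exists (a' ++ a2); last exact: IHs.
  by right; exists (b' ++ b2); last exact: IHs.
move=> Fl Fr; rewrite !unshuffle_sum_cat unshuffle_sum_signed.
apply: eq_unshuffle_sum => a1 b1 sp1 /=.
rewrite !signedD !unshuffle_sum_signed -!addrA.
rewrite [X in _ = _ + X]addrCA.
congr (_ + (_ + (_ + _))); apply: eq_unshuffle_sum => a2 b2 sp2.
all: rewrite ?(Fl _ _ _ (unshuffled_cat _ _ _ _ sp1 sp2)).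
all: rewrite ?(Fr _ _ _ (unshuffled_cat _ _ _ _ sp1 sp2)) !signedK.
all: congr signed; rewrite /swap_sign !wpar_cons !wpar_nil /=.
all: by do 2!case: (odd (size _)); do 2!case: (wpar _); do 2!case: (oddz _).
Qed.

End Sum.

Lemma unshuffle_sum_morph (U V : zmodType) (g : U -> V) s
    (F : seq T -> seq T -> U) :
  (forall u v, g (u + v) = g u + g v) ->
  g (unshuffle_sum s F) = unshuffle_sum s (fun a b => g (F a b)).
Proof.
move=> gD; elim: s F => [|x s IHs] F //=; rewrite gD !IHs; congr (_ + _).
by apply: eq_unshuffle_sum => a b _; rewrite signed_morph.
Qed.

End Words.

(** * Unshuffles as permutations *)

Lemma big_take_tuple (R : Type) (idx : R) (op : Monoid.com_law idx) (T : Type)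
    n (t : n.-tuple T) (m : nat) (f : T -> R) :
  \big[op/idx]_(z <- take m t) f z =
  \big[op/idx]_(p < n | (p < m)%N) f (tnth t p).
Proof.
case: n t => [|n] t; first by rewrite tuple0 big_ord0 big_nil.
pose x0 := thead t.
rewrite (big_nth x0) size_take_min size_tuple.
rewrite (eq_bigr (fun p : 'I_n.+1 => f (nth x0 t p))); last first.
  by move=> p _; rewrite (tnth_nth x0).
rewrite -(big_mkord (fun p => (p < m)%N) (fun p => f (nth x0 t p))).
rewrite (@big_nat_widen _ _ _ 0 (minn m n.+1) n.+1) ?geq_minr //.
rewrite big_nat_cond [RHS]big_nat_cond; apply: eq_big => p.
  by rewrite ltn_min; case: (p < m)%N; case: (p < n.+1)%N; rewrite ?andbF.
by case/and3P=> _ _; rewrite ltn_min => /andP[lt_pm _]; rewrite nth_take.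
Qed.

(** A permutation amounts to the position of its smallest value together with a
    permutation of the other values; inductions on [n] below rest on this. *)
Lemma lift_perm_bij n :
  bijective (fun p : 'I_n.+1 * 'S_n => lift_perm p.1 ord0 p.2).
Proof.
apply: inj_card_bij => [[i s] [j t] /= e|]; last first.
  by rewrite card_prod card_ord !card_Sn factS.
have eij : i = j.
  apply: (@perm_inj _ (lift_perm i ord0 s)).
  by rewrite lift_perm_id e lift_perm_id.
subst j; congr pair; apply/permP => p; apply: (@lift_inj _ ord0).
by rewrite -!(lift_perm_lift i ord0) e.
Qed.

Lemma big_lift_perm (R : Type) (idx : R) (op : Monoid.com_law idx) n
    (P : pred 'S_n.+1) (f : 'S_n.+1 -> R) :
  \big[op/idx]_(sigma : 'S_n.+1 | P sigma) f sigma =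
  \big[op/idx]_(i < n.+1) \big[op/idx]_(s : 'S_n | P (lift_perm i ord0 s))
     f (lift_perm i ord0 s).
Proof.
rewrite pair_big_dep /= (reindex _ (onW_bij _ (lift_perm_bij n))) /=.
by [].
Qed.

Section LiftPerm.
Variables (T : Type) (deg : T -> int) (n : nat).
Implicit Types (x : T) (y : n.-tuple T) (s : 'S_n) (i : 'I_n.+1).

Lemma permute_lift x y i s :
  permute (lift_perm i ord0 s) (cons_tuple x y) =
  take i (permute s y) ++ x :: drop i (permute s y) :> seq T.
Proof.
have sz_take : size (take i (permute s y)) = i.
  by rewrite size_takel // size_tuple -ltnS.
apply: (@eq_from_nth _ x) => [|j].
  rewrite size_tuple size_cat /= addnS -size_cat cat_take_drop.
  by rewrite size_tuple ?card_ord.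
rewrite size_tuple => lt_jn; pose p := Ordinal lt_jn.
rewrite -[j]/(nat_of_ord p) -tnth_nth tnth_mktuple nth_cat sz_take.
case: (unliftP i p) => [q ->|->]; last first.
  by rewrite lift_perm_id ltnn subnn.
rewrite lift_perm_lift /=.
have -> : tnth (cons_tuple x y) (lift ord0 (s q)) = nth x (permute s y) q.
  by rewrite -[RHS](tnth_nth x (permute s y)) tnth_mktuple !(tnth_nth x).
rewrite /bump; case: (leqP i q) => le_iq.
  rewrite ltnNge (leq_trans le_iq (leq_addl _ _)) /= add1n subSn //=.
  by rewrite nth_drop subnKC.
by rewrite add0n le_iq nth_take.
Qed.

Variable k : fieldType.

(** The first letter, now at position [i], has jumped over the [i] letters in
    front of it; these are the new inversions, which account for the change of
    both factors of [chi]. *)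
Lemma chi_lift x y i s :
  chi k (map_tuple deg (cons_tuple x y)) (lift_perm i ord0 s) =
  chi k (map_tuple deg y) s *
    (-1) ^+ swap_sign deg [:: x] (take i (permute s y)).
Proof.
have sz_take : size (take i (permute s y)) = i.
  by rewrite size_takel // size_tuple -ltnS.
have tnth_lift p : tnth (map_tuple deg (cons_tuple x y)) (lift ord0 p)
    = tnth (map_tuple deg y) p.
  by rewrite !tnth_map (tnth_nth x) /= -(tnth_nth x).
have tnth_0 : tnth (map_tuple deg (cons_tuple x y)) ord0 = deg x.
  by rewrite tnth_map.
have lt_bump h p q : (bump h p < bump h q)%N = (p < q)%N.
  by rewrite /bump; lia.
have key : koszul k (map_tuple deg (cons_tuple x y)) (lift_perm i ord0 s) =
    koszul k (map_tuple deg y) s *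
    (-1) ^+ (oddz (deg x) && wpar deg (take i (permute s y))).
  rewrite /koszul (bigD1_ord i) //= big_pred0 ?mul1r; last first.
    by move=> j; rewrite lift_perm_id ltn0 andbF.
  rewrite -[X in _ = _ * X]mulr1 -oddzM -exprN1z.
  have -> : (-1 : k) ^ (deg x * wdeg deg (take i (permute s y))) =
      \prod_(p < n | (p < i)%N) (-1) ^ (deg (tnth y (s p)) * deg x).
    rewrite mulrC /wdeg big_take_tuple mulr_suml.
    rewrite (big_morph _ (fun a b => expfzDr a b _) (expr0z _)) ?oppr_eq0 ?oner_eq0 //.
    by apply: eq_bigr => p _; rewrite tnth_mktuple.
  rewrite mulr1 [X in _ = _ * X]big_mkcond -big_split /=.
  apply: eq_bigr => p _.
  rewrite big_mkcond (bigD1_ord i) //= mulrC [X in _ = X * _]big_mkcond /=.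
  congr (_ * _).
    apply: eq_bigr => q _; rewrite !lift_perm_lift !tnth_lift.
    by rewrite /= !lt_bump.
  rewrite lift_perm_id lift_perm_lift tnth_lift tnth_0 tnth_map /= andbT.
  suff -> : (bump i p < i)%N = (p < i)%N by [].
  by rewrite /bump; lia.
rewrite /chi odd_lift_perm addbF key /swap_sign sz_take wpar_cons wpar_nil addbF.
by rewrite andTb !signr_addb [X in X * _]mulrC mulrACA [X in _ * X]mulrC.
Qed.

End LiftPerm.

Lemma unshuffleP n t (s : 'S_n) :
  reflect (forall p q : 'I_n, (p < q)%N -> (q < t)%N || (t <= p)%N ->
             (s p < s q)%N) (unshuffle t s).
Proof.
apply: (iffP forallP) => [h p q lt_pq pq | h p].
  by have /forallP/(_ q) := h p; rewrite lt_pq pq.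
by apply/forallP => q; apply/implyP => /andP[lt_pq pq]; apply: h.
Qed.

(** The smallest value of an unshuffle is the head of one of the two blocks. *)
Lemma unshuffle_lift n t (i : 'I_n.+1) (s : 'S_n) :
  unshuffle t (lift_perm i ord0 s) =
  [&& i == 0%N :> nat, (0 < t)%N & unshuffle t.-1 s] ||
  ((i == t :> nat) && unshuffle t s).
Proof.
apply/idP/idP => [/unshuffleP sh | ].
  have restrict t' : (forall p q : 'I_n, (q < t')%N || (t' <= p)%N ->
      (bump i q < t)%N || (t <= bump i p)%N) -> unshuffle t' s.
    move=> ht; apply/unshuffleP => p q lt_pq pq.
    have := sh (lift i p) (lift i q); rewrite !lift_perm_lift /=.
    by rewrite /bump /= !add1n ltnS; apply; [lia | apply: ht].
  case: (eqVneq (nat_of_ord i) t) => [eit | neit] /=.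
    by rewrite (restrict t) ?orbT // => p q; rewrite eit /bump; lia.
  case: (posnP i) => [i0 | i_gt0].
    rewrite orbF /= lt0n -i0 eq_sym neit /=.
    by apply: restrict => p q; rewrite i0 /bump; lia.
  exfalso.
  case: (ltngtP i t) neit => // [lt_it | lt_ti] _.
    by have := sh ord0 i i_gt0; rewrite lt_it lift_perm_id => /(_ isT).
  have lt_tn : (t < n.+1)%N by apply: ltn_trans lt_ti _.
  by have := sh (Ordinal lt_tn) i lt_ti;
    rewrite /= leqnn orbT lift_perm_id => /(_ isT).
case/orP=> [/and3P[/eqP i0 t_gt0 /unshuffleP sh] | /andP[/eqP eit /unshuffleP sh]].
  apply/unshuffleP => p q lt_pq.
  case: (unliftP i p) lt_pq => [p' ->|->]; case: (unliftP i q) => [q' ->|->];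
    rewrite ?lift_perm_id ?lift_perm_lift /= ?i0 ?ltnn //.
  by rewrite /bump /= !add1n !ltnS => lt_pq pq; apply: sh => //; lia.
apply/unshuffleP => p q lt_pq.
case: (unliftP i p) lt_pq => [p' ->|->]; case: (unliftP i q) => [q' ->|->];
  rewrite ?lift_perm_id ?lift_perm_lift /= ?eit ?ltnn //.
  by rewrite /bump /= !add1n !ltnS => lt_pq pq; apply: sh => //; lia.
by rewrite /bump; lia.
Qed.

Lemma unshuffle_minus_lift n t (i : 'I_n.+1) (s : 'S_n) : (t < n)%N ->
  unshuffle_minus t.+1 (lift_perm i ord0 s) =
  (i == 0%N :> nat) && unshuffle t s.
Proof.
move=> lt_tn; rewrite /unshuffle_minus unshuffle_lift andbA andbT.
case: eqP => [i0 | ni0] /=.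
  have -> : (nat_of_ord i == t.+1) = false by rewrite i0.
  rewrite orbF; apply: andb_idr => _; apply/forallP => p; apply/forallP => q.
  apply/implyP => /andP[/eqP p0 /eqP qt].
  have -> : p = i by apply: val_inj; rewrite /= p0 i0.
  rewrite lift_perm_id.
  case: (unliftP i q) => [q' ->|qi]; first by rewrite lift_perm_lift.
  by move: qt; rewrite qi i0.
apply/negbTE/negP => /andP[/andP[/eqP it _] /forallP/(_ ord0)/forallP/(_ i)].
by rewrite it /= eqxx /= lift_perm_id ltn0.
Qed.

Section UnshuffleSums.
Variables (k : fieldType) (V : lmodType k) (T : Type) (deg : T -> int).
Implicit Types (n : nat) (F : seq T -> seq T -> V).

Lemma sum_unshuffle_lift n (x : T) (y : n.-tuple T) F t :
  \sum_(sigma : 'S_n.+1 | unshuffle t sigma)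
    chi k (map_tuple deg (cons_tuple x y)) sigma *:
      F (take t (permute sigma (cons_tuple x y)))
        (drop t (permute sigma (cons_tuple x y))) =
  (if t is t'.+1 then
     \sum_(s : 'S_n | unshuffle t' s) chi k (map_tuple deg y) s *:
       F (x :: take t' (permute s y)) (drop t' (permute s y)) else 0) +
  (if (t <= n)%N then
     \sum_(s : 'S_n | unshuffle t s) chi k (map_tuple deg y) s *:
       signed (swap_sign deg [:: x] (take t (permute s y)))
         (F (take t (permute s y)) (x :: drop t (permute s y))) else 0).
Proof.
rewrite big_lift_perm.
pose h i (s : 'S_n) := (chi k (map_tuple deg y) s *
   (-1) ^+ swap_sign deg [:: x] (take i (permute s y))) *:
     F (take t (take i (permute s y) ++ x :: drop i (permute s y)))
       (drop t (take i (permute s y) ++ x :: drop i (permute s y))).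
transitivity (\sum_(i < n.+1)
   ((if [&& i == 0%N :> nat & (0 < t)%N] then
      \sum_(s : 'S_n | unshuffle t.-1 s) h 0%N s else 0) +
    (if i == t :> nat then \sum_(s : 'S_n | unshuffle t s) h t s else 0))).
  apply: eq_bigr => i _.
  transitivity (\sum_(s | unshuffle t (lift_perm i ord0 s)) h i s).
    by apply: eq_bigr => s _; rewrite permute_lift chi_lift.
  under eq_bigl => s do rewrite unshuffle_lift.
  case: (eqVneq (nat_of_ord i) t) => [<- | neit] /=.
    case: (posnP i) => [-> /= | i_gt0]; rewrite ?add0r //.
  case: eqP => [-> | _] /=; last by rewrite addr0 big_pred0.
  rewrite addr0; case: (posnP t) => [-> | t_gt0]; first by rewrite big_pred0.
  by apply: eq_bigl => s; rewrite orbF.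
rewrite big_split /=; congr (_ + _).
  rewrite big_ord_recl [X in _ + X]big1 ?addr0 /=; last by move=> j _.
  move: @h; case: t => [|t] h //=; apply: eq_bigr => s _.
  by rewrite /h take0 drop0 /= /swap_sign wpar_nil andbF /= mulr1.
rewrite -big_mkcond /=.
case: leqP => [le_tn | lt_nt]; last first.
  by rewrite big_pred0 // => i; apply/eqP => eit; move: (ltn_ord i); lia.
rewrite -ltnS in le_tn.
rewrite (big_pred1 (Ordinal le_tn)) //; apply: eq_bigr => s _.
have sz_take : size (take t (permute s y)) = t.
  by rewrite size_takel // size_tuple -ltnS.
rewrite /h take_cat drop_cat sz_take ltnn subnn take0 drop0 cats0.
by rewrite signedE scalerA.
Qed.

(** Decomposing a permutation according to the position of the first letter
    turns a sum over unshuffles into the recursion defining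
    [unshuffle_sum]. *)
Lemma sum_unshuffle n (y : n.-tuple T) F :
  \sum_(0 <= t < n.+1) \sum_(sigma : 'S_n | unshuffle t sigma)
    chi k (map_tuple deg y) sigma *:
      F (take t (permute sigma y)) (drop t (permute sigma y)) =
  unshuffle_sum deg y F.
Proof.
elim: n y F => [|n IHn] y F.
  rewrite big_nat1 (big_pred1 1%g); last first.
    move=> s; have -> : s = 1%g by apply/permP => -[].
    by rewrite /= eqxx; apply/unshuffleP => -[].
  rewrite /chi odd_perm1 expr0 mul1r /koszul big_ord0 scale1r.
  have nil0 (z : 0.-tuple T) : z = [::] :> seq T by rewrite tuple0.
  by rewrite take0 drop0 !nil0.
rewrite (tuple_eta y); set x := thead y; set y' := behead_tuple y.
rewrite -[[tuple of x :: y']]/(cons_tuple x y').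
under eq_bigr => t _ do rewrite sum_unshuffle_lift.
rewrite big_split /= -[in RHS](IHn y') -[in RHS](IHn y'); congr (_ + _).
  by rewrite big_nat_recl // add0r.
rewrite big_nat_recr //= ltnn addr0 big_nat_cond [RHS]big_nat_cond.
by apply: eq_bigr => t; rewrite ltnS => /andP[/andP[_ ->] _].
Qed.

(** The condition defining S^- puts the first letter in the first block. The
    word sum has one more term, with an empty second block, which the
    hypothesis on [F] removes. *)
Lemma sum_unshuffle_minus n (x : T) (y : n.-tuple T) F :
  (forall a, F a [::] = 0) ->
  \sum_(1 <= t < n.+1) \sum_(sigma : 'S_n.+1 | unshuffle_minus t sigma)
    chi k (map_tuple deg (cons_tuple x y)) sigma *:
      F (take t (permute sigma (cons_tuple x y)))
        (drop t (permute sigma (cons_tuple x y))) =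
  unshuffle_sum deg y (fun a b => F (x :: a) b).
Proof.
move=> F0; rewrite -sum_unshuffle [RHS]big_nat_recr //=.
rewrite [X in _ = _ + X]big1 ?addr0; last first.
  by move=> s _; rewrite drop_oversize ?F0 ?scaler0 //= size_map size_enum_ord.
rewrite big_add1 /= big_nat [RHS]big_nat; apply: eq_bigr => t /andP[_ lt_tn].
rewrite big_lift_perm big_ord_recl /= [X in _ + X]big1 ?addr0 => [|i _]; last first.
  by rewrite big_pred0 // => s; rewrite unshuffle_minus_lift.
under eq_bigl => s do rewrite unshuffle_minus_lift //=.
apply: eq_bigr => s _; rewrite permute_lift chi_lift /= take0 drop0.
by rewrite /swap_sign wpar_nil andbF /= mulr1.
Qed.

End UnshuffleSums.

(** The symmetric group is generated by adjacent transpositions; here a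
    permutation is undone by moving the first letter back to the front, one
    transposition at a time. *)
Lemma skew_of_swaps (k : fieldType) (V : lmodType k) (T : eqType)
    (deg : T -> int) (good : T -> Prop) (f : seq T -> V) :
  (forall s1 x y s2, (forall z, z \in s1 ++ x :: y :: s2 -> good z) ->
     f (s1 ++ x :: y :: s2) =
     signed (swap_sign deg [:: x] [:: y]) (f (s1 ++ y :: x :: s2))) ->
  forall n (y : n.-tuple T) (sigma : 'S_n), (forall z, z \in y -> good z) ->
  f (permute sigma y) = chi k (map_tuple deg y) sigma *: f y.
Proof.
move=> skew n; elim: n f skew => [|n IHn] f skew y sigma gy.
  rewrite /chi /koszul big_ord0 (_ : sigma = 1%g).
    by rewrite odd_perm1 mulr1 scale1r (tuple0 (permute 1%g y)) (tuple0 y).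
  by apply/permP => -[].
have front s1 a x s2 : (forall z, z \in s1 ++ a ++ x :: s2 -> good z) ->
    f (s1 ++ a ++ x :: s2) =
    signed (swap_sign deg [:: x] a) (f (s1 ++ x :: a ++ s2)).
  elim: a s1 => [|z a IHa] s1 gs /=.
    by rewrite /swap_sign wpar_nil andbF.
  have gz : forall u, u \in s1 ++ z :: x :: a ++ s2 -> good u.
    move=> u hu; apply: gs; move: hu; rewrite !(mem_cat, inE).
    by do !case: (_ \in _); do !case: (_ == _).
  rewrite -cat_rcons IHa ?cat_rcons // skew // signedK; congr signed.
  rewrite /swap_sign !wpar_cons wpar_nil /=.
  by do 2!case: (oddz _); case: (wpar _); case: (odd _).
have [g gK Kg] := lift_perm_bij n.
rewrite -(Kg sigma); case: (g sigma) => i s /= {sigma}.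
move: gy; rewrite (tuple_eta y); set x := thead y; set y' := behead_tuple y.
rewrite -[[tuple of x :: y']]/(cons_tuple x y') => gy.
have g' z : z \in permute s y' -> good z.
  move=> /tnthP[p ->]; rewrite tnth_mktuple; apply: gy.
  by rewrite inE mem_tnth orbT.
rewrite permute_lift chi_lift (front [::]) /=; last first.
  move=> z; rewrite mem_cat inE orbCA -mem_cat cat_take_drop => /orP[/eqP -> |].
    by apply: gy; rewrite inE eqxx.
  exact: g'.
rewrite cat_take_drop (IHn (fun a => f (x :: a))).
- by rewrite signedE scalerA mulrC.
- move=> s1 u v s2 gz; apply: (skew (x :: s1)) => z.
  by rewrite inE => /orP[/eqP ->|/gz //]; apply: gy; rewrite inE eqxx.
- by move=> z zy; apply: gy; rewrite inE zy orbT.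
Qed.

(** * Operations on graded words *)

Section GradedWords.
Variables (k : fieldType) (B : gradedSpace k).

(** A vector with a declared degree. Signs are computed from declared degrees,
    so that operations on words make sense, and are linear in the vectors,
    whether or not the vectors are homogeneous. *)
Definition letter : Type := (int * B)%type.
Implicit Types (a b c e p s w : seq letter) (x y : letter).

(** The declared degrees are the actual ones. *)
Definition good w : Prop := forall x, x \in w -> gpart x.1 x.2.

Lemma good_cons x w : good (x :: w) <-> gpart x.1 x.2 /\ good w.
Proof.
split=> [g | [gx gw] y].
  split; first by apply: g; rewrite inE eqxx.
  by move=> y yw; apply: g; rewrite inE yw orbT.
by rewrite inE => /orP[/eqP ->|/gw].
Qed.

Lemma good_cat a b : good (a ++ b) <-> good a /\ good b.
Proof.
split=> [g | [ga gb] x].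
  by split=> x xw; apply: g; rewrite mem_cat xw ?orbT.
by rewrite mem_cat => /orP[/ga|/gb].
Qed.

Lemma good_unshuffled w a b : unshuffled w a b -> good w -> good a /\ good b.
Proof.
elim: w a b => [|x w IHw] a b /=; first by case=> -> ->.
case=> [[a' -> /IHw g] | [b' -> /IHw g]] /good_cons[gx /g[ga gb]].
  by split=> //; apply/good_cons.
by split=> //; apply/good_cons.
Qed.

Local Notation wd := (wdeg fst).
Local Notation wp := (wpar (fst : letter -> int)).
Local Notation sum := (unshuffle_sum (fst : letter -> int)).
Local Notation swp := (swap_sign (fst : letter -> int)).

Definition head_additive (V : zmodType) (f : seq letter -> V) : Prop :=
  forall m u v s, f ((m, u + v) :: s) = f ((m, u) :: s) + f ((m, v) :: s).

Lemma head_additive0 (V : zmodType) (f : seq letter -> V) m s :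
  head_additive f -> f ((m, 0) :: s) = 0.
Proof. by move=> fD; apply: (addrI (f ((m, 0) :: s))); rewrite -fD !addr0. Qed.

Section Insertion.
Variable lam : seq letter -> B.

(** The output of an operation of degree [2 - n] on [n] letters. *)
Definition out a : letter := (wd a + 2 - (size a)%:Z, lam a).

Lemma oddz_out a : oddz (out a).1 = wp a (+) odd (size a).
Proof. by rewrite /out !oddzD oddzN addbF. Qed.

(** Composition of [f] with the coderivation induced by the components of [lam]
    whose arity satisfies [r]. *)
Definition insert (V : zmodType) (r : pred nat) (f : seq letter -> V) w : V :=
  sum w (fun a b => if r (size a) then
    signed (odd (size a) && odd (size b)) (f (out a :: b)) else 0).

(** For [r = leq 1] this is the left-hand side of the generalized Jacobi
    identity. As both the inner and the outer arity are restricted, it is the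
    square of the unary component for [r = pred1 1]. *)
Definition self_insert (r : pred nat) w : B :=
  sum w (fun a b => if r (size a) && r (size b).+1 then
    signed (odd (size a) && odd (size b)) (lam (out a :: b)) else 0).

Lemma insert_leq1 (V : zmodType) (f : seq letter -> V) w :
  insert (leq 1) f w = insert (leq 2) f w + insert (pred1 1%N) f w.
Proof.
rewrite -unshuffle_sumD; apply: eq_unshuffle_sum => a b _ /=.
by case: (size a) => [|[|m]] //=; rewrite ?addr0 ?add0r.
Qed.

Lemma insertD (V : zmodType) r (f g h : seq letter -> V) w :
  (forall p, f p = g p + h p) ->
  insert r f w = insert r g w + insert r h w.
Proof.
move=> fgh; rewrite -unshuffle_sumD; apply: eq_unshuffle_sum => a b _.
by case: (r _); rewrite ?addr0 // fgh signedD.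
Qed.

Lemma insertN (V : zmodType) r (f : seq letter -> V) w :
  insert r (fun p => - f p) w = - insert r f w.
Proof.
rewrite unshuffle_sumN; apply: eq_unshuffle_sum => a b _.
by case: (r _); rewrite ?oppr0 // signedN.
Qed.

Lemma eq_insert (V : zmodType) (r : pred nat) (f g : seq letter -> V) w :
  (forall a b, unshuffled w a b -> r (size a) ->
     f (out a :: b) = g (out a :: b)) ->
  insert r f w = insert r g w.
Proof.
move=> fg; apply: eq_unshuffle_sum => a b sp.
by case: ifP => // ra; rewrite fg.
Qed.

Lemma insert_morph (U V : zmodType) r (g : U -> V) (f : seq letter -> U) w :
  (forall u v, g (u + v) = g u + g v) ->
  g (insert r f w) = insert r (fun p => g (f p)) w.
Proof.
move=> gD; rewrite (unshuffle_sum_morph _ _ _ gD); apply: eq_unshuffle_sum => a b _.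
case: (r _); first by rewrite signed_morph.
by apply: (addrI (g 0)); rewrite -gD !addr0.
Qed.

Hypothesis lam_deg : forall a, good a -> gpart (out a).1 (out a).2.

(** The square of an odd coderivation is a coderivation: when the second
    insertion does not involve the output of the first one, exchanging the two
    insertions changes the sign, and these terms cancel. The sign of
    [odd (size e)] appears because the square has degree 1 more. *)
Lemma insert_insert (V : zmodType) (r : pred nat) (f : seq letter -> V) w :
  (forall v : V, v + v = 0 -> v = 0) -> head_additive f ->
  (forall x y s, good (x :: y :: s) ->
    f (x :: y :: s) = signed (swp [:: x] [:: y]) (f (y :: x :: s))) ->
  good w ->
  insert r (insert r f) w =
  sum w (fun p e =>
    signed ((odd (size p) && odd (size e)) (+) odd (size e))
      (f ((wd p + 3 - (size p)%:Z, self_insert r p) :: e))).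
Proof.
move=> no2 fD fskew gw.
(* In [X] the output of the first insertion is fed to the second one; in [Y] the
   two insertions act on disjoint blocks. *)
pose X a c e := if r (size a) && r (size c).+1 then
  signed ((odd (size a) && (odd (size c) (+) odd (size e))) (+)
          (~~ odd (size c) && odd (size e))) (f (out (out a :: c) :: e)) else 0.
pose Y a c e := if r (size a) && r (size c) then
  signed ((odd (size a) && (odd (size c) (+) odd (size e))) (+)
          swp [:: out a] c (+) (odd (size c) && ~~ odd (size e)))
     (f [:: out c, out a & e]) else 0.
transitivity (sum w (fun a b => sum b (fun c e => X a c e)) +
              sum w (fun a b => sum b (fun c e => Y a c e))).
  rewrite -unshuffle_sumD; apply: eq_unshuffle_sum => a b sp.
  rewrite /insert /= signedD !unshuffle_sum_signed /X /Y.
  case: (r (size a)) => /=; last by rewrite !unshuffle_sum0 ?addr0.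
  congr (_ + _); apply: eq_unshuffle_sum => c e sp'.
    rewrite (unshuffled_size sp') oddD /=.
    by case: ifP => _; rewrite ?signed0 // !signedK.
  rewrite (unshuffled_size sp') oddD /=.
  by case: ifP => _; rewrite ?signed0 // !signedK addbA.
have -> : sum w (fun a b => sum b (fun c e => Y a c e)) = 0.
  apply: no2; rewrite [X in X + _]unshuffle_sumCA -unshuffle_sumD.
  apply: unshuffle_sum0 => a b sp; rewrite -unshuffle_sumD.
  apply: unshuffle_sum0 => c e sp'.
  have [ga gb] := good_unshuffled sp gw; have [gc ge] := good_unshuffled sp' gb.
  rewrite /Y [r (size c) && _]andbC; case: ifP => _; last by rewrite signed0 addr0.
  rewrite fskew; last by do 2?[apply/good_cons; split; first exact: lam_deg].
  rewrite !signedK /swap_sign !wpar_cons !wpar_nil !oddz_out /=.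
  by do 3!case: (odd (size _)); do 2!case: (wp _); rewrite /= ?addNr ?addrN.
rewrite addr0 unshuffle_sumA; apply: eq_unshuffle_sum => p e sp.
rewrite (unshuffle_sum_morph _ (g := fun z => f ((_, z) :: e))); last first.
  by move=> u v; rewrite fD.
rewrite unshuffle_sum_signed; apply: eq_unshuffle_sum => a c sp'.
rewrite /X; case: ifP => _; last by rewrite head_additive0 ?signed0.
rewrite (signed_morph (f := fun z => f ((_, z) :: e))); last first.
  by move=> u v; rewrite fD.
rewrite signedK (unshuffled_size sp') (unshuffled_wdeg _ sp') oddD.
congr signed; last first.
  congr (f ((_, _) :: e)); rewrite wdeg_cons [size (_ :: _)]/= [(out _).1]/=.
  by move: (wd a) (wd c) => da dc; lia.
by do 3!case: (odd (size _)).
Qed.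

End Insertion.

Variable C : dgLie k.

Lemma bracketDl (x y z : C) : bracket (x + y) z = bracket x z + bracket y z.
Proof. by have := bracket_linl z 1 x y; rewrite !scale1r. Qed.

Lemma bracketDr (x y z : C) : bracket x (y + z) = bracket x y + bracket x z.
Proof. by have := bracket_linr x 1 y z; rewrite !scale1r. Qed.

Lemma bracket0l (z : C) : bracket 0 z = 0.
Proof. by apply: (addrI (bracket 0 z)); rewrite -bracketDl !addr0. Qed.

Lemma bracket0r (z : C) : bracket z 0 = 0.
Proof. by apply: (addrI (bracket z 0)); rewrite -bracketDr !addr0. Qed.

Lemma bracket_signedl i (x z : C) :
  bracket (signed i x) z = signed i (bracket x z).
Proof.
exact: (signed_morph (f := fun u : C => bracket u z) (fun u v => bracketDl u v z)).
Qed.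

Lemma bracket_signedr i (x z : C) :
  bracket z (signed i x) = signed i (bracket z x).
Proof. exact: (signed_morph (bracketDr z)). Qed.

(** The exponent of [kappa] modulo 2, for the blocks [a] and [b]. *)
Definition kap a b : bool := ~~ odd (size a) (+) (~~ odd (size b) && wp a).

(** The bracket of the convolution Lie algebra of maps from the exterior
    coalgebra to [C]. *)
Definition cup (f h : seq letter -> C) w : C :=
  sum w (fun a b => signed (kap a b) (bracket (f a) (h b))).

(** A coderivation acts on the convolution algebra as a derivation. *)
Lemma insert_cup lam (r : pred nat) (f : seq letter -> C) w :
  insert lam r (cup f f) w =
  - sum w (fun p e => signed (kap p e)
      (bracket (insert lam r f p) (f e) +
       signed (~~ (wp p (+) odd (size p)))
         (bracket (f p) (insert lam r f e)))).
Proof.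
pose X a c e := if r (size a) then
  signed ((odd (size a) && (odd (size c) (+) odd (size e))) (+)
   kap (out lam a :: c) e) (bracket (f (out lam a :: c)) (f e)) else 0.
pose Y a c e := if r (size a) then
  signed ((odd (size a) && (odd (size c) (+) odd (size e))) (+)
   swp [:: out lam a] c (+) kap c (out lam a :: e))
   (bracket (f c) (f (out lam a :: e))) else 0.
transitivity (sum w (fun a b => sum b (fun c e => X a c e)) +
              sum w (fun a b => sum b (fun c e => Y a c e))).
  rewrite -unshuffle_sumD; apply: eq_unshuffle_sum => a b sp /=.
  rewrite /X /Y; case: (r _); last by rewrite !unshuffle_sum0 ?addr0.
  rewrite signedD !unshuffle_sum_signed.
  congr (_ + _); apply: eq_unshuffle_sum => c e sp'.
    by rewrite (unshuffled_size sp') oddD signedK.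
  by rewrite (unshuffled_size sp') oddD !signedK.
rewrite unshuffle_sumN.
under [in RHS]eq_unshuffle_sum => p e _ do rewrite signedD opprD.
rewrite unshuffle_sumD [in LHS]unshuffle_sumA [X in _ + X]unshuffle_sumCA.
congr (_ + _); apply: eq_unshuffle_sum => p e sp.
  rewrite /insert (unshuffle_sum_morph _ (g := fun z => bracket z (f e))); last first.
    by move=> u v; rewrite bracketDl.
  rewrite unshuffle_sum_signed unshuffle_sumN; apply: eq_unshuffle_sum => a c sp'.
  rewrite /X; case: (r _); last by rewrite bracket0l signed0 oppr0.
  rewrite bracket_signedl signedK -[- signed _ _]/(signed true _) signedK.
  congr signed; rewrite /kap !wpar_cons (unshuffled_wpar _ sp') (unshuffled_size sp').
  rewrite oddD !oddz_out /=.
  by do 3!case: (odd (size _)); do 2!case: (wp _).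
rewrite /insert (unshuffle_sum_morph _ (g := bracket (f p))); last first.
  by move=> u v; rewrite bracketDr.
rewrite !unshuffle_sum_signed unshuffle_sumN; apply: eq_unshuffle_sum => a c sp'.
rewrite /Y; case: (r _); last by rewrite bracket0r !signed0 oppr0.
rewrite bracket_signedr !signedK -[- signed _ _]/(signed true _) !signedK.
congr signed; rewrite /kap /swap_sign !wpar_cons wpar_nil (unshuffled_size sp').
rewrite oddD !oddz_out /=.
by do 3!case: (odd (size _)); do 2!case: (wp _).
Qed.

Lemma bracket_anti_signed m n (x y : C) : gpart m x -> gpart n y ->
  bracket x y = signed (~~ (oddz m && oddz n)) (bracket y x).
Proof.
move=> gx gy; rewrite (bracket_anti gx gy) exprN1z oddzM -signedE.
by case: (_ && _); rewrite //= opprK.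
Qed.

Lemma bracket_jacobi_signed m n q (x y z : C) :
  gpart m x -> gpart n y -> gpart q z ->
  bracket x (bracket y z) = bracket (bracket x y) z +
    signed (oddz m && oddz n) (bracket y (bracket x z)).
Proof.
by move=> gx gy gz; rewrite (bracket_jacobi gx gy gz) exprN1z oddzM -signedE.
Qed.

Lemma bracket_leibniz_signed m n (x y : C) : gpart m x -> gpart n y ->
  cdiff C (bracket x y) =
  bracket (cdiff C x) y + signed (oddz m) (bracket x (cdiff C y)).
Proof. by move=> gx gy; rewrite (bracket_leibniz gx gy) exprN1z -signedE. Qed.

Section CupSquare.
Variable f : seq letter -> C.
Hypothesis f_deg :
  forall a, good a -> gpart (wd a + 1 - (size a)%:Z) (f a).

Lemma oddz_f_deg a : oddz (wd a + 1 - (size a)%:Z) = ~~ (wp a (+) odd (size a)).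
Proof. by rewrite !oddzD oddzN -/(wp a) addbT -addNb. Qed.

Lemma cdiff_cup w : good w ->
  cdiff C (cup f f w) =
  sum w (fun p e => signed (kap p e)
    (bracket (cdiff C (f p)) (f e) +
     signed (~~ (wp p (+) odd (size p))) (bracket (f p) (cdiff C (f e))))).
Proof.
move=> gw; rewrite /cup (unshuffle_sum_morph _ _ _ (lin_morphD (cdiff C))).
apply: eq_unshuffle_sum => p e sp; have [gp ge] := good_unshuffled sp gw.
rewrite (signed_morph (lin_morphD (cdiff C))).
by rewrite (bracket_leibniz_signed (f_deg gp) (f_deg ge)) oddz_f_deg.
Qed.

(** The Jacobi identity [[f, [f, f]] = 0] for an odd element [f] of the
    convolution algebra. Let [SA] and [SB] be the sums of the brackets
    associated to the left and to the right: the Jacobi identity of [C] gives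
    [SB = - SA - SB], its antisymmetry gives [SB = SA], whence [3 SA = 0]. *)
Lemma cup_jacobi w : (forall z : C, z *+ 3 = 0 -> z = 0) -> good w ->
  sum w (fun p e => signed (kap p e)
    (bracket (cup f f p) (f e) +
     signed (~~ (wp p (+) odd (size p))) (bracket (f p) (cup f f e)))) = 0.
Proof.
move=> no3 gw.
pose A a c e := signed (kap (a ++ c) e (+) kap a c)
  (bracket (bracket (f a) (f c)) (f e)).
pose b_sign a c e :=
  kap a (c ++ e) (+) ~~ (wp a (+) odd (size a)) (+) kap c e.
pose Bk a c e := signed (b_sign a c e) (bracket (f a) (bracket (f c) (f e))).
pose SA := sum w (fun p e => sum p (fun a c => A a c e)).
pose SB := sum w (fun a b => sum b (fun c e => Bk a c e)).
transitivity (SA + SB).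
  rewrite -unshuffle_sumD; apply: eq_unshuffle_sum => p e sp; rewrite signedD.
  congr (_ + _); rewrite /cup.
    rewrite (unshuffle_sum_morph _ (g := fun u => bracket u (f e))); last first.
      by move=> u v; rewrite bracketDl.
    rewrite unshuffle_sum_signed; apply: eq_unshuffle_sum => a c sp'.
    rewrite bracket_signedl signedK /A; congr signed.
    rewrite /kap wpar_cat size_cat (unshuffled_wpar _ sp') (unshuffled_size sp').
    by [].
  rewrite (unshuffle_sum_morph _ (g := bracket (f p))); last first.
    by move=> u v; rewrite bracketDr.
  rewrite !unshuffle_sum_signed; apply: eq_unshuffle_sum => a c sp'.
  rewrite bracket_signedr !signedK /Bk; congr signed.
  by rewrite /b_sign /kap size_cat (unshuffled_size sp').
have eqB : SB = - SA - SB.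
  rewrite {1}/SB.
  transitivity (sum w (fun a b => sum b (fun c e => - A a c e)) +
    sum w (fun a b => sum b (fun c e =>
      signed (b_sign a c e (+) (~~ (wp a (+) odd (size a)) &&
                                ~~ (wp c (+) odd (size c))))
       (bracket (f c) (bracket (f a) (f e)))))).
    rewrite -unshuffle_sumD; apply: eq_unshuffle_sum => a b sp.
    rewrite -unshuffle_sumD; apply: eq_unshuffle_sum => c e sp'.
    have [ga gb] := good_unshuffled sp gw.
    have [gc ge] := good_unshuffled sp' gb.
    rewrite /Bk (bracket_jacobi_signed (f_deg ga) (f_deg gc) (f_deg ge)).
    rewrite !oddz_f_deg signedD signedK; congr (_ + _).
    rewrite -[- A _ _ _]/(signed true _) signedK; congr signed.
    rewrite /b_sign /kap wpar_cat !size_cat !oddD.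
    by do 3!case: (odd (size _)); do 2!case: (wp _).
  congr (_ + _).
    rewrite unshuffle_sumA unshuffle_sumN; apply: eq_unshuffle_sum => p e _.
    by rewrite unshuffle_sumN.
  rewrite unshuffle_sumCA unshuffle_sumN; apply: eq_unshuffle_sum => a b _.
  rewrite unshuffle_sumN; apply: eq_unshuffle_sum => c e _.
  rewrite -[- Bk _ _ _]/(signed true _) !signedK; congr signed.
  rewrite /b_sign /kap /swap_sign !size_cat !oddD.
  by do 3!case: (odd (size _)); do 2!case: (wp _).
have eqAB : SB = SA.
  rewrite /SB /SA unshuffle_sumC; apply: eq_unshuffle_sum => p e sp.
  rewrite unshuffle_sum_signed; apply: eq_unshuffle_sum => a c sp'.
  have [gp ge] := good_unshuffled sp gw.
  have [ga gc] := good_unshuffled sp' gp.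
  rewrite /Bk /A (bracket_anti_signed (f_deg ge)
                    (bracket_deg (f_deg ga) (f_deg gc))).
  rewrite !signedK (oddzD (wd a + 1 - (size a)%:Z)) !oddz_f_deg; congr signed.
  rewrite /b_sign /kap /swap_sign wpar_cat !size_cat !oddD.
  rewrite (unshuffled_wpar _ sp') (unshuffled_size sp') oddD.
  by do 3!case: (odd (size _)); do 3!case: (wp _).
rewrite eqAB in eqB *; rewrite -mulr2n.
suff -> : SA = 0 by rewrite mul0rn.
by apply: no3; rewrite !mulrSr mulr0n add0r {1}eqB subrK addNr.
Qed.

(** Half of [cup f f], as a sum over the unshuffles of S^-. *)
Definition half_cup w : C :=
  if w is x :: s then
    sum s (fun a b => signed (kap (x :: a) b) (bracket (f (x :: a)) (f b)))
  else 0.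

(** Exchanging the two blocks pairs the unshuffles having the first letter in
    the second block with the ones having it in the first block. *)
Lemma cup_half w : f [::] = 0 -> good w -> cup f f w = half_cup w + half_cup w.
Proof.
move=> f0; case: w => [|x s] gw; first by rewrite /cup /= f0 bracket0l signed0 addr0.
rewrite /cup /=; congr (_ + _); rewrite unshuffle_sumC.
apply: eq_unshuffle_sum => a b sp.
have [gx /(good_unshuffled sp)[ga gb]] := (good_cons x s).1 gw.
have gxa : good (x :: a) by apply/good_cons.
rewrite (bracket_anti_signed (f_deg gb) (f_deg gxa)) !signedK !oddz_f_deg.
congr signed; rewrite /kap /swap_sign !wpar_cons wpar_nil /=.
by do 2!case: (odd (size _)); do 2!case: (wp _); case: (oddz _).
Qed.

End CupSquare.

End GradedWords.

(** * Homotopy transfer on graded words *)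

Section Transfer.
Variables (k : fieldType) (C : dgLie k) (B : cochainComplex k).
Variables (G : {linear B -> C}) (F : {linear C -> B}) (H : {linear C -> C}).
Variables (lam : seq (letter B) -> B) (Phi : seq (letter B) -> C).
Implicit Types (a b c e p s w : seq (letter B)) (x y : letter B).

Local Notation wd := (wdeg fst).
Local Notation wp := (wpar (fst : letter B -> int)).
Local Notation sum := (unshuffle_sum (fst : letter B -> int)).
Local Notation swp := (swap_sign (fst : letter B -> int)).
Local Notation half := (half_cup Phi).

Hypothesis no2 : forall V : lmodType k, forall z : V, z + z = 0 -> z = 0.
Hypothesis no3 : forall V : lmodType k, forall z : V, z *+ 3 = 0 -> z = 0.

Hypothesis Phi_nil : Phi [::] = 0.
Hypothesis lam_deg : forall a, good a -> gpart (out lam a).1 (out lam a).2.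
Hypothesis Phi_deg :
  forall a, good a -> gpart (wd a + 1 - (size a)%:Z) (Phi a).
Hypothesis PhiD : head_additive Phi.
Hypothesis lam1 : forall x, lam [:: x] = cdiff B x.2.
Hypothesis Phi1 : forall x, Phi [:: x] = G x.2.
Hypothesis lam_rec : forall w, good w -> (1 < size w)%N -> lam w = F (half w).
Hypothesis Phi_rec : forall w, good w -> (1 < size w)%N ->
  Phi w = H (half w - insert lam (leq 2) Phi w).

Lemma good_out a b : good a -> good b -> good (out lam a :: b).
Proof. by move=> ga gb; apply/good_cons; split=> //; apply: lam_deg. Qed.

(** The length is bounded so that skew symmetry can be proved by induction along
    the recursion. *)
Definition swap_skew (V : zmodType) (n : nat) (f : seq (letter B) -> V) :=
  forall s1 x y s2, good (s1 ++ x :: y :: s2) ->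
  (size (s1 ++ x :: y :: s2) <= n)%N ->
  f (s1 ++ x :: y :: s2) =
  signed (swp [:: x] [:: y]) (f (s1 ++ y :: x :: s2)).

Lemma good_swap s1 x y s2 :
  good (s1 ++ x :: y :: s2) -> good (s1 ++ y :: x :: s2).
Proof.
by move=> /good_cat[g1 /good_cons[gx /good_cons[gy g2]]];
  apply/good_cat; split=> //; do 2?[apply/good_cons; split=> //].
Qed.

Lemma good_middle s1 s s2 : good (s1 ++ s ++ s2) -> good (s1 ++ s2).
Proof.
by move=> /good_cat[g1 /good_cat[_ g2]]; apply/good_cat.
Qed.

Lemma good_insert2 s1 x y s2 a1 a2 b :
  good (s1 ++ x :: y :: s2) -> unshuffled (s1 ++ s2) (a1 ++ a2) b ->
  good (a1 ++ x :: y :: a2) /\ good b.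
Proof.
move=> g sp; have [ga gb] := good_unshuffled sp (good_middle (s := [:: x; y]) g).
split=> //; move: g ga => /good_cat[_ /good_cons[gx /good_cons[gy _]]].
by move=> /good_cat[g1 g2]; apply/good_cat; split=> //;
  do 2?[apply/good_cons; split=> //].
Qed.

(** In [cup Phi Phi], which is twice [half], both blocks play the same role, as
    the sum is not restricted to S^-. A block of full length faces the empty
    word, hence the gain of one in the bound. *)
Lemma half_skew n : swap_skew n Phi -> swap_skew n.+1 half.
Proof.
move=> skew s1 x y s2 gw le_n; set i := swp _ _.
set w := s1 ++ _ in gw le_n *; set w' := s1 ++ _.
have eq_cup : cup Phi Phi w = signed i (cup Phi Phi w').
  rewrite /cup unshuffle_sum_swap //.
    move=> a1 a2 b sp; have [ga gb] := good_insert2 gw sp.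
    case: (posnP (size b)) => [/size0nil -> | b_gt0].
      by rewrite Phi_nil !bracket0r !signed0.
    rewrite skew //; last first.
      move: (unshuffled_size sp) le_n; rewrite /w !size_cat /=; lia.
    rewrite bracket_signedl !signedK addbC; congr (signed (_ (+) _)).
    by rewrite /kap !wpar_cat !size_cat !wpar_cons /= [oddz x.1 (+) (_ (+) _)]addbCA.
  move=> a b1 b2 sp.
  have [gb ga] := good_insert2 gw (unshuffledC sp).
  case: (posnP (size a)) => [/size0nil -> | a_gt0].
    by rewrite Phi_nil !bracket0l !signed0.
  rewrite skew //; last first.
    move: (unshuffled_size sp) le_n; rewrite /w !size_cat /=; lia.
  rewrite bracket_signedr !signedK addbC; congr (signed (_ (+) _)).
  by rewrite /kap !size_cat.
have gw' : good w' by apply: good_swap.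
move: eq_cup; rewrite !(cup_half Phi_deg) // signedD => e.
by apply/eqP; rewrite -subr_eq0; apply/eqP/no2; rewrite addrACA e -opprD subrr.
Qed.

Lemma insert_skew n : swap_skew n lam -> swap_skew n.-1 Phi ->
  swap_skew n (insert lam (leq 2) Phi).
Proof.
move=> lskew skew s1 x y s2 gw le_n; rewrite /insert unshuffle_sum_swap //.
  move=> a1 a2 b sp; have [ga gb] := good_insert2 gw sp.
  rewrite !size_cat /=; case: ifP => _; last by rewrite signed0.
  rewrite signedK addbC -signedK; congr signed.
  have -> : out lam (a1 ++ [:: x, y & a2]) =
      ((out lam (a1 ++ [:: y, x & a2])).1,
       signed (swp [:: x] [:: y]) (lam (a1 ++ [:: y, x & a2]))).
    congr pair; last first.
      apply: lskew => //; apply: leq_trans le_n.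
      by move: (unshuffled_size sp); rewrite !size_cat /=; lia.
    by rewrite /out /= !size_cat !wdeg_cat !wdeg_cons /= [x.1 + (y.1 + _)]addrCA.
  by rewrite (signed_morph (f := fun z => Phi ((_, z) :: b))).
move=> a b1 b2 sp; have [gb ga] := good_insert2 gw (unshuffledC sp).
case: ifP => a_ge2; last by rewrite signed0.
rewrite -!cat_cons skew; first by rewrite signedK addbC -signedK !size_cat.
  by rewrite cat_cons; apply: good_out.
move: (unshuffled_size sp) le_n; rewrite !size_cat /=; lia.
Qed.

Lemma transfer_skew n : swap_skew n lam /\ swap_skew n Phi.
Proof.
elim: n => [|n [IHl IHp]].
  by split=> s1 x y s2 _; rewrite size_cat /= addnS ltn0.
have size2 s1 x y s2 : (1 < size (s1 ++ x :: y :: s2))%N.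
  by rewrite size_cat /=; lia.
have hs := half_skew IHp.
have ls : swap_skew n.+1 lam.
  move=> s1 x y s2 gw le_n; rewrite !lam_rec //; last exact: good_swap.
  by rewrite hs // (signed_morph (lin_morphD F)).
split=> // s1 x y s2 gw le_n; rewrite !Phi_rec //; last exact: good_swap.
rewrite hs // (insert_skew ls IHp) // -signedN -signedD.
by rewrite (signed_morph (lin_morphD H)).
Qed.

Hypothesis F_diff : forall z, F (cdiff C z) = cdiff B (F z).
Hypothesis G_diff : forall z, G (cdiff B z) = cdiff C (G z).
Hypothesis FG_id : forall z, F (G z) = z.
Hypothesis GF_homotopy :
  forall z, G (F z) - z = H (cdiff C z) + cdiff C (H z).
Hypothesis FH_0 : forall z, F (H z) = 0.

(** The Maurer-Cartan defect, that is the left-hand side of the weak morphism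
    equation. *)
Definition mc_defect w : C :=
  cdiff C (Phi w) - insert lam (leq 1) Phi w + half w.

(** The sum [u + v], from which the homotopy produces [Phi]. *)
Definition source w : C := half w - insert lam (leq 2) Phi w.

(** As [F H = 0], composing with [F] kills [Phi] on words of length at least 2, so
    that only the insertion of the whole word survives; since [F G = 1], it is
    [lam w], which is also [F (half w)]. *)
Lemma F_source w : good w -> (1 < size w)%N -> F (source w) = 0.
Proof.
move=> gw w_gt1; rewrite lin_morphB -lam_rec //.
rewrite [X in _ - X](insert_morph _ _ _ _ (lin_morphD F)).
rewrite /insert; apply/eqP; rewrite subr_eq0 eq_sym; apply/eqP.
rewrite -[RHS](unshuffle_sum_nilr (fst : letter B -> int)).
transitivity (sum w (fun a b => if b is [::] then
   (if (1 < size a)%N then lam a else 0) else 0)).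
  apply: eq_unshuffle_sum => a b sp; have [ga gb] := good_unshuffled sp gw.
  case: b sp gb => [|x b] sp gb /=.
    by rewrite Phi1 FG_id andbF.
  case: ifP => // _; rewrite Phi_rec //; last exact: good_out.
  by rewrite FH_0 signed0.
apply: eq_unshuffle_sum => a [|x b] // /unshuffled_size.
by rewrite addn0 => <-; rewrite w_gt1.
Qed.

(** Since [F (source w) = 0], the homotopy identity computes the differential of
    [Phi w = H (source w)] as [- source w - H (d (source w))]; the first term
    cancels the terms of the defect that do not involve [l_1]. *)
Lemma mc_defect_source w : good w -> (1 < size w)%N ->
  mc_defect w =
  - H (cdiff C (source w) + insert lam (pred1 1%N) source w).
Proof.
move=> gw w_gt1; rewrite /mc_defect insert_leq1.
have -> : insert lam (pred1 1%N) Phi w = H (insert lam (pred1 1%N) source w).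
  rewrite (insert_morph _ _ _ _ (lin_morphD H)); apply: eq_insert => a b sp /= /eqP a1.
  have [ga gb] := good_unshuffled sp gw.
  rewrite Phi_rec //; first exact: good_out.
  by move: (unshuffled_size sp) => /=; lia.
have -> : cdiff C (Phi w) = - source w - H (cdiff C (source w)).
  have := GF_homotopy (source w); rewrite F_source // lin_morph0 sub0r => ->.
  by rewrite Phi_rec // [RHS]addrC addKr.
rewrite (lin_morphD H) /source; set hh := half w; set ii := insert _ _ _ w.
set h1 := H _; set h2 := H _.
rewrite opprB !opprD [LHS](AC (3*2*1) ((1*4)*(2*6)*(3*5)))%AC /=.
by rewrite subrr addNr !add0r.
Qed.

(** The differential of [B], extended to words as a coderivation, squares to
    zero. *)
Lemma insert1_insert1 w : good w ->
  insert lam (pred1 1%N) (insert lam (pred1 1%N) Phi) w = 0.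
Proof.
move=> gw; rewrite insert_insert //.
- apply: unshuffle_sum0 => p e _.
  have -> : self_insert lam (pred1 1%N) p = 0.
    apply: unshuffle_sum0 => a [|x b] _ /=; last by rewrite andbF.
    case: a => [|x [|y a]] //=; last first.
    by rewrite !lam1 /= lam1 cdiffK.
  by rewrite head_additive0 ?signed0.
- exact: no2.
- move=> x y s gs; exact: ((transfer_skew _).2 [::] x y s gs (leqnn _)).
Qed.

(** If [Phi] is a morphism on shorter words, then [d Phi] can be replaced by
    [Phi Q - half] in the Leibniz rule: [insert_cup] identifies the
    contribution of [Phi Q], and that of [half] is zero by the Jacobi
    identity. *)
Lemma cdiff_half w : good w ->
  (forall p, good p -> (size p < size w)%N -> mc_defect p = 0) ->
  cdiff C (half w) = - insert lam (leq 1) half w.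
Proof.
move=> gw mc0.
have cupE p : good p -> cup Phi Phi p = half p + half p by exact: cup_half.
have dPhi p e : unshuffled w p e -> good p -> e <> [::] ->
    cdiff C (Phi p) = insert lam (leq 1) Phi p - half p.
  move=> sp gp e0; apply/eqP; rewrite -subr_eq0 opprB addrA addrAC.
  apply/eqP; apply: mc0 => //; rewrite (unshuffled_size sp).
  by case: e e0 {sp} => //= *; lia.
(* Half of the left-hand side of the Jacobi identity. *)
pose K := sum w (fun p e => signed (kap p e)
  (bracket (half p) (Phi e) +
   signed (~~ (wp p (+) odd (size p))) (bracket (Phi p) (half e)))).
have K0 : K = 0.
  apply: no2; rewrite -unshuffle_sumD -[RHS](cup_jacobi Phi_deg (@no3 C) gw).
  apply: eq_unshuffle_sum => p e sp; have [gp ge] := good_unshuffled sp gw.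
  rewrite !cupE // bracketDl bracketDr !signedD addrACA.
  by [].
apply/eqP; rewrite -subr_eq0 opprK; apply/eqP/no2.
rewrite addrACA -(lin_morphD (cdiff C)) -cupE //.
have <- : insert lam (leq 1) (cup Phi Phi) w =
    insert lam (leq 1) half w + insert lam (leq 1) half w.
  rewrite -unshuffle_sumD; apply: eq_unshuffle_sum => a b sp.
  have [ga gb] := good_unshuffled sp gw.
  case: ifP => _; last by rewrite addr0.
  by rewrite cupE ?signedD //; apply: good_out.
rewrite cdiff_cup // insert_cup unshuffle_sumN -unshuffle_sumD.
rewrite -[RHS]oppr0 -K0 /K [RHS]unshuffle_sumN; apply: eq_unshuffle_sum => p e sp.
have [gp ge] := good_unshuffled sp gw.
have -> : bracket (cdiff C (Phi p)) (Phi e) =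
    bracket (insert lam (leq 1) Phi p - half p) (Phi e).
  case: e sp {ge} => [|x e] sp; first by rewrite Phi_nil !bracket0r.
  by rewrite (dPhi p _ sp).
have -> : bracket (Phi p) (cdiff C (Phi e)) =
    bracket (Phi p) (insert lam (leq 1) Phi e - half e).
  case: p sp {gp} => [|x p] sp; first by rewrite Phi_nil !bracket0l.
  by rewrite (dPhi e _ (unshuffledC sp)).
rewrite bracketDl bracketDr -signedN -signedD -[in RHS]signedN; congr signed.
set i1 := bracket (insert _ _ _ _) _; set i2 := bracket _ (insert _ _ _ _).
have -> : bracket (- half p) (Phi e) = - bracket (half p) (Phi e).
  exact: (bracket_signedl true).
have -> : bracket (Phi p) (- half e) = - bracket (Phi p) (half e).
  exact: (bracket_signedr true).
rewrite signedD signedN !opprD [LHS](AC ((2*2)*2) ((1*5)*(3*6)*(2*4)))%AC /=.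
by rewrite !addrN !add0r.
Qed.

(** The generalized Jacobi identity in arity [n] is obtained by applying [F] to
    the formula for [d W + W Q1], where [W] is [source]; the formula and
    [mc_defect_source] then give the morphism equation in the same arity. *)
Lemma mc_relations n w : good w -> size w = n ->
  mc_defect w = 0 /\ self_insert lam (leq 1) w = 0.
Proof.
elim/ltn_ind: n w => n IHn w gw sz_w.
have IH p : good p -> (size p < size w)%N ->
    mc_defect p = 0 /\ self_insert lam (leq 1) p = 0.
  by move=> gp; rewrite sz_w => lt_p; apply: IHn lt_p _ gp _.
case: (ltnP 1 (size w)) => [w_gt1 | ]; last first.
  case: w gw sz_w {IH} => [|x [|]] // gw _ _.
    by rewrite /mc_defect /insert /self_insert /= Phi_nil lin_morph0 subr0 addr0.
  rewrite /mc_defect /insert /self_insert /= Phi_nil bracket0r !signed0 !addr0.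
  by rewrite !Phi1 /= !lam1 /= lam1 G_diff subrr cdiffK.
have cdiff_source : cdiff C (source w) + insert lam (pred1 1%N) source w =
    - insert lam (leq 1) (insert lam (leq 1) Phi) w.
  have -> : cdiff C (source w) = - insert lam (leq 1) half w -
      insert lam (leq 2) (insert lam (leq 1) Phi) w + insert lam (leq 2) half w.
    rewrite lin_morphB cdiff_half // => [|p gp lt_p]; last by case: (IH p gp lt_p).
    rewrite -addrA; congr (_ + _); rewrite [RHS]addrC -[RHS]opprB; congr (- _).
    rewrite (insert_morph _ _ _ _ (lin_morphD (cdiff C))) -insertN.
    rewrite -(@insertD _ _ lam _ (leq 2) (fun p => insert lam (leq 1) Phi p - half p)) //.
    apply: eq_insert => a b sp a_ge2.
    have [ga gb] := good_unshuffled sp gw.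
    have [|] := IH (out lam a :: b) (good_out ga gb).
      by rewrite (unshuffled_size sp) /=; lia.
    move=> /eqP; rewrite /mc_defect -addrA addr_eq0 => /eqP -> _.
    by rewrite opprD opprK.
  rewrite insert_leq1 [in RHS]insert_leq1.
  rewrite (@insertD _ _ lam _ (pred1 1%N) (insert lam (leq 1) Phi)
    (insert lam (leq 2) Phi) (insert lam (pred1 1%N) Phi)); last first.
    by move=> p; rewrite insert_leq1.
  rewrite insert1_insert1 // addr0.
  rewrite (@insertD _ _ lam _ (pred1 1%N) source half
    (fun p => - insert lam (leq 2) Phi p)) // insertN.
  rewrite !opprD.
  set t1 := insert _ _ half w; set t2 := insert _ _ half w.
  set t3 := insert _ _ _ w; set t4 := insert _ _ _ w.
  rewrite [LHS](AC (4*2) ((1*4)*(2*5)*(3*6)))%AC /=.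
  by rewrite !addNr !add0r.
have insert_insertE : insert lam (leq 1) (insert lam (leq 1) Phi) w =
    G (self_insert lam (leq 1) w).
  rewrite insert_insert //; first last.
  - move=> x y s gs; exact: ((transfer_skew _).2 [::] x y s gs (leqnn _)).
  - exact: no2.
  rewrite -(unshuffle_sum_nilr (fst : letter B -> int) w
    (fun p => G (self_insert lam (leq 1) p))).
  apply: eq_unshuffle_sum => p [|x e] sp; first by rewrite andbF Phi1.
  have [gp ge] := good_unshuffled sp gw.
  have [|_ ->] := IH p gp; first by rewrite (unshuffled_size sp) /=; lia.
  by rewrite head_additive0 ?signed0.
have J0 : self_insert lam (leq 1) w = 0.
  rewrite -[LHS]FG_id -insert_insertE -[insert _ _ _ _]opprK -cdiff_source.
  apply/eqP; rewrite (lin_morphN F) oppr_eq0; apply/eqP.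
  rewrite (lin_morphD F) F_diff F_source // lin_morph0 add0r.
  rewrite (insert_morph _ _ _ _ (lin_morphD F)).
  apply: unshuffle_sum0 => a b sp; have [ga gb] := good_unshuffled sp gw.
  case: ifP => // /eqP a1; rewrite F_source ?signed0 //; first exact: good_out.
  by move: (unshuffled_size sp) => /=; lia.
rewrite mc_defect_source // cdiff_source insert_insertE J0.
by rewrite lin_morph0 oppr0 lin_morph0 oppr0.
Qed.

End Transfer.

(** * Operations on vectors as operations on graded words *)

Section OnWords.
Variables (k : fieldType) (B : gradedSpace k).

Definition vectors (w : seq (letter B)) : seq B := [seq x.2 | x <- w].

(** The value at the empty word is set to 0, so that the insertions of, and the
    brackets with, the empty word do not contribute. *)
Definition on_words (V : zmodType) (f : seq B -> V) (w : seq (letter B)) : V :=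
  if w is [::] then 0 else f (vectors w).

Lemma permute_map (T U : Type) (g : T -> U) n (y : n.-tuple T) (sigma : 'S_n) :
  permute sigma (map_tuple g y) = map_tuple g (permute sigma y).
Proof. by apply: eq_from_tnth => i; rewrite tnth_mktuple !tnth_map tnth_ord_tuple. Qed.

Lemma on_wordsE (V : zmodType) (f : seq B -> V) w :
  (0 < size w)%N -> on_words f w = f (vectors w).
Proof. by case: w. Qed.

Lemma homogeneousP n (d : n.-tuple int) (x : n.-tuple B) : homogeneous d x ->
  exists y : n.-tuple (letter B),
    [/\ good y, d = map_tuple fst y & x = map_tuple snd y].
Proof.
move=> hx; exists [tuple (tnth d i, tnth x i) | i < n]; split.
- by move=> z /tnthP[i ->]; rewrite tnth_mktuple; apply: hx.
- by apply: eq_from_tnth => i; rewrite tnth_map tnth_mktuple.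
- by apply: eq_from_tnth => i; rewrite tnth_map tnth_mktuple.
Qed.

Lemma good_homogeneous n (y : n.-tuple (letter B)) :
  good y -> homogeneous (map_tuple fst y) (map_tuple snd y).
Proof. by move=> gy i; rewrite !tnth_map; apply: gy; apply: mem_tnth. Qed.

Lemma wdeg_tuple n (y : n.-tuple (letter B)) :
  wdeg fst y = \sum_(i < n) tnth (map_tuple fst y) i.
Proof. by rewrite /wdeg big_tuple; apply: eq_bigr => i _; rewrite tnth_map. Qed.

Lemma multilinear_head (V : gradedSpace k) (f : seq B -> V) :
  multilinear f -> head_additive (on_words f).
Proof.
by move=> fL m a b s; have := fL [::] (vectors s) 1 a b; rewrite /= !scale1r.
Qed.

Lemma op_degree_on_words (V : gradedSpace k) (m : int) (f : seq B -> V) :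
  op_degree (fun n => m - n%:Z) f ->
  forall w, good w -> gpart (wdeg fst w + m - (size w)%:Z) (on_words f w).
Proof.
move=> fd w gw; case: (posnP (size w)) => [/size0nil -> | w_gt0].
  exact: gpart0.
rewrite on_wordsE //.
have := fd _ _ _ w_gt0 (@good_homogeneous _ (in_tuple w) gw).
by rewrite -wdeg_tuple addrA.
Qed.

Lemma big_nat_low (V : nmodType) (m n : nat) (f : nat -> V) :
  (m <= n)%N -> (forall t, (t < m)%N -> f t = 0) ->
  \sum_(0 <= t < n) f t = \sum_(m <= t < n) f t.
Proof.
by move=> le_mn f0; rewrite (@big_cat_nat _ _ _ m) //= big_nat big1 ?add0r.
Qed.

(** Insertion into [f], with the signs of the generalized Jacobi identities. *)
Lemma sum_insert_op (V : gradedSpace k) (f : seq B -> V) (l : seq B -> B)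
    (m c n : nat) (y : n.-tuple (letter B)) : (0 < m <= n.+1)%N ->
  \sum_(m <= i < n.+1) \sum_(sigma : 'S_n | unshuffle i sigma)
    ((-1) ^+ (i * (n - i) + c) * chi k (map_tuple fst y) sigma) *:
      insert_op f l i (permute sigma (map_tuple snd y)) =
  signed (odd c) (insert (on_words l) (leq m) (on_words f) y).
Proof.
case/andP=> m_gt0 le_mn; rewrite unshuffle_sum_signed -sum_unshuffle.
rewrite (big_nat_low le_mn) => [|t lt_tm].
  rewrite big_nat [RHS]big_nat; apply: eq_bigr => t /andP[le_mt lt_tn].
  apply: eq_bigr => s _.
  have sz_take : size (take t (permute s y)) = t.
    by rewrite size_takel // size_tuple -ltnS.
  rewrite sz_take le_mt size_drop size_tuple signedK signedE scalerA.
  rewrite mulrC; congr (_ * _ *: _).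
    by rewrite -signr_odd oddD oddM addbC.
  rewrite /insert_op permute_map on_wordsE //.
  rewrite /out on_wordsE ?sz_take ?(leq_trans m_gt0) //.
  by rewrite /vectors /= map_take map_drop.
rewrite big1 // => s _.
rewrite size_takel ?size_tuple; last by lia.
by rewrite leqNgt lt_tm /= signed0 scaler0.
Qed.

Lemma sum_bracket_op (C : dgLie k) (f : seq B -> C) n
    (y : n.-tuple (letter B)) : (0 < n)%N ->
  \sum_(1 <= t < n) \sum_(tau : 'S_n | unshuffle_minus t tau)
    (chi k (map_tuple fst y) tau * kappa k (map_tuple fst y) tau t) *:
      bracket_op f t (permute tau (map_tuple snd y)) =
  half_cup (on_words f) y.
Proof.
case: n y => // n y _.
rewrite (tuple_eta y); set x := thead y; set y' := behead_tuple y.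
rewrite -[[tuple of x :: y']]/(cons_tuple x y') [half_cup _ _]/=.
rewrite -(sum_unshuffle_minus _ _ _ (F := fun a b => signed (kap a b)
  (bracket (on_words f a) (on_words f b)))); last first.
  by move=> a; rewrite bracket0r signed0.
rewrite big_nat [RHS]big_nat; apply: eq_bigr => t /andP[t_gt0 lt_tn].
apply: eq_bigr => s _; set z := permute s (cons_tuple x y').
have sz_take : size (take t z) = t by rewrite size_takel // size_tuple ltnW.
have sz_drop : size (drop t z) = (n.+1 - t)%N by rewrite size_drop size_tuple.
rewrite signedE scalerA; congr (_ * _ *: _).
  rewrite /kappa exprN1z; congr (_ ^+ _); congr nat_of_bool.
  have -> : \sum_(p < n.+1 | (p < t)%N) tnth (map_tuple fst (cons_tuple x y')) (s p) =
      wdeg fst (take t z).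
    rewrite /wdeg big_take_tuple; apply: eq_bigr => p _.
    by rewrite /z tnth_mktuple tnth_map.
  rewrite /kap sz_take sz_drop !(oddzD, oddzM, oddzN) !oddz_nat -/(wpar _ _).
  rewrite oddB ?(ltnW lt_tn) // [odd 1]/= !addbT /=.
  by case: (odd t); case: (odd n); case: (wpar _ _).
rewrite /bracket_op permute_map -/z /= on_wordsE ?sz_take //.
by rewrite on_wordsE ?sz_drop ?subn_gt0 // /vectors map_take map_drop.
Qed.

End OnWords.

(** * Solutions of the recursion are transferred structures *)

Section TransferTheorem.
Variables (k : fieldType) (k_char0 : [pchar k] =i pred0).
Variables (C : dgLie k) (B : cochainComplex k).
Variables (G : {linear B -> C}) (F : {linear C -> B}) (H : {linear C -> C}).
Hypothesis F_diff : forall z, F (cdiff C z) = cdiff B (F z).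
Hypothesis G_diff : forall z, G (cdiff B z) = cdiff C (G z).
Hypothesis FG_id : forall z, F (G z) = z.
Hypothesis GF_homotopy :
  forall z, G (F z) - z = H (cdiff C z) + cdiff C (H z).
Hypothesis FH_0 : forall z, F (H z) = 0.

Lemma char0_torsionfree n (V : lmodType k) (z : V) : z *+ n.+1 = 0 -> z = 0.
Proof.
move/eqP; rewrite -scaler_nat scaler_eq0 ((pcharf0P k).1 k_char0).
by move=> /eqP.
Qed.

Variables (l : seq B -> B) (u v phi : seq B -> C).
Hypothesis T : is_transfer F G H l u v phi.

Local Notation lam := (on_words l).
Local Notation Phi := (on_words phi).

Lemma transfer_rec_words w : good w -> (1 < size w)%N ->
  lam w = F (half_cup Phi w) /\
  Phi w = H (half_cup Phi w - insert lam (leq 2) Phi w).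
Proof.
move=> gw w_gt1; have w_gt0 := ltnW w_gt1.
have [] := transfer_rec T w_gt1 (@good_homogeneous _ _ _ (in_tuple w) gw).
rewrite sum_bracket_op // (@sum_insert_op _ _ _ phi l 2 1 _ (in_tuple w)) //.
by rewrite !on_wordsE //= => ev -> eu ->; rewrite ev eu addrC.
Qed.

Let no2 (V : lmodType k) (z : V) : z + z = 0 -> z = 0.
Proof. by rewrite -mulr2n => /char0_torsionfree. Qed.

Let no3 (V : lmodType k) (z : V) : z *+ 3 = 0 -> z = 0.
Proof. exact: char0_torsionfree. Qed.

Let lam_deg a : good a -> gpart (out lam a).1 (out lam a).2.
Proof. by have [ld _ _ _] := transfer_degree T; apply: op_degree_on_words. Qed.

Let Phi_deg a : good a -> gpart (wdeg fst a + 1 - (size a)%:Z) (Phi a).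
Proof. by have [_ _ _ pd] := transfer_degree T; apply: op_degree_on_words. Qed.

Let PhiD : head_additive Phi.
Proof. by have [_ _ _ pl] := transfer_linear T; apply: multilinear_head. Qed.

Let lam1 x : lam [:: x] = cdiff B x.2.
Proof. by have [] := transfer_1 T x.2. Qed.

Let Phi1 x : Phi [:: x] = G x.2.
Proof. by have [] := transfer_1 T x.2. Qed.

Let lam_rec w (gw : good w) (w_gt1 : (1 < size w)%N) :=
  (transfer_rec_words gw w_gt1).1.
Let Phi_rec w (gw : good w) (w_gt1 : (1 < size w)%N) :=
  (transfer_rec_words gw w_gt1).2.

Lemma skew_on_words (V : gradedSpace k) (f : seq B -> V) :
  (forall n, swap_skew n (on_words f)) -> skew_symmetric f.
Proof.
move=> skew n d x n_gt0 /homogeneousP[y [gy -> ->]] sigma; rewrite permute_map.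
have := skew_of_swaps (f := on_words f) (good := fun z : letter B => gpart z.1 z.2)
  (fun s1 x y s2 g => skew _ s1 x y s2 g (leqnn _)) sigma gy.
by rewrite !on_wordsE ?size_tuple.
Qed.

Lemma transfer_Linfty_morphism : is_Linfty l /\ is_weak_morphism l phi.
Proof.
have skew n := transfer_skew no2 (erefl : Phi [::] = 0) lam_deg Phi_deg PhiD
  lam_rec Phi_rec n.
have rel w gw := mc_relations no2 no3
  (erefl : Phi [::] = 0) lam_deg Phi_deg PhiD lam1 Phi1 lam_rec Phi_rec
  F_diff G_diff FG_id GF_homotopy FH_0 (w := w) gw (erefl _).
have [ll _ _ pl] := transfer_linear T; have [ld _ _ pd] := transfer_degree T.
split; split=> //.
- by apply: skew_on_words => n; case: (skew n).
- move=> n d x n_gt0 /homogeneousP[y [gy -> ->]].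
  rewrite -[RHS](rel y gy).2 /=.
  transitivity (insert lam (leq 1) lam y); last first.
    by apply: eq_unshuffle_sum => a b _; rewrite andbT.
  rewrite -[RHS]/(signed (odd 0) _) -sum_insert_op //.
  rewrite big_nat [RHS]big_nat; apply: eq_bigr => i /andP[i_gt0 lt_in].
  by apply: eq_bigr => s _; rewrite addn0 subSn // subn1.
- by apply: skew_on_words => n; case: (skew n).
move=> n d x n_gt0 /homogeneousP[y [gy -> ->]].
rewrite sum_bracket_op // -[RHS](rel y gy).1 /mc_defect.
congr (_ + _ + _); first by rewrite on_wordsE ?size_tuple.
rewrite -[RHS]/(signed (odd 1) _) -sum_insert_op //.
rewrite big_nat [RHS]big_nat; apply: eq_bigr => i /andP[i_gt0 lt_in].
by apply: eq_bigr => s _; rewrite subSn // subn1 mulrC.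
Qed.

End TransferTheorem.

(** * Parity projections of a graded space *)

Section Parity.
Variables (k : fieldType) (V : gradedSpace k).

Lemma gpartD p (x y : V) : gpart p x -> gpart p y -> gpart p (x + y).
Proof. by move=> gx gy; rewrite -[x]scale1r; apply: gpartP. Qed.

Lemma gpartZ p c (x : V) : gpart p x -> gpart p (c *: x).
Proof. by move=> gx; rewrite -[_ *: _]addr0; apply: gpartP => //; apply: gpart0. Qed.

Lemma gpart_signed p b (x : V) : gpart p x -> gpart p (signed b x).
Proof. by rewrite signedE; apply: gpartZ. Qed.

(** The even and odd parts are determined because the sum of the homogeneous
    subspaces is direct. Signs only depend on parities, and two projections
    avoid sums over all degrees. *)
Lemma parity_projections : exists e : bool -> V -> V,
  [/\ forall b, linear (e b), forall x, x = e false x + e true x &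
      forall b p x, gpart p x -> e b x = if oddz p == b then x else 0].
Proof.
pose R (bx : bool * V) (y : V) := exists (s : seq int) (c : int -> V),
  [/\ uniq s, forall p, gpart p (c p), bx.2 = \sum_(p <- s) c p &
      y = \sum_(p <- s | oddz p == bx.1) c p].
have [f Rf] : exists f, forall bx, R bx (f bx).
  apply: functional_choice => -[b x]; have [s [c [us gc ->]]] := gpart_span x.
  by exists (\sum_(p <- s | oddz p == b) c p), s, c.
have Rlin b c x y x' y' : R (b, x) y -> R (b, x') y' ->
    R (b, c *: x + x') (c *: y + y').
  move=> [s [f1 [us g1 /= -> ->]]] [s' [f2 [us' g2 /= -> ->]]].
  pose z1 p := if p \in s then f1 p else 0.
  pose z2 p := if p \in s' then f2 p else 0.
  exists (undup (s ++ s')), (fun p => c *: z1 p + z2 p).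
  have ext (P : pred int) (r : seq int) (h : int -> V) : uniq r ->
      {subset r <= s ++ s'} -> \sum_(p <- r | P p) h p =
      \sum_(p <- undup (s ++ s') | P p) (if p \in r then h p else 0).
    move=> ur sub; rewrite -big_mkcondr -[LHS]big_filter -[RHS]big_filter.
    apply/perm_big/uniq_perm.
    - exact: filter_uniq.
    - exact/filter_uniq/undup_uniq.
    move=> p; rewrite !mem_filter mem_undup; case: (P p) => //=.
    by case pr: (p \in r) => //=; rewrite sub.
  have sub1 : {subset s <= s ++ s'} by move=> p ps; rewrite mem_cat ps.
  have sub2 : {subset s' <= s ++ s'} by move=> p ps; rewrite mem_cat ps orbT.
  split; rewrite ?undup_uniq //.
  - move=> p; apply: gpartP; rewrite /z1 /z2; case: ifP => // _; exact: gpart0.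
  - by rewrite /= big_split /= -scaler_sumr (ext predT s) // (ext predT s').
  - by rewrite /= big_split /= -scaler_sumr (ext _ s) // (ext _ s').
have R0 b y : R (b, 0) y -> y = 0.
  move=> [s [c [us gc /esym /= s0 ->]]]; rewrite big_seq_cond big1 // => p /andP[ps _].
  exact: gpart_free us gc s0 p ps.
have Runiq b x y y' : R (b, x) y -> R (b, x) y' -> y = y'.
  move=> Ry Ry'; apply/eqP; rewrite -subr_eq0 addrC -scaleN1r; apply/eqP.
  by apply: (R0 b); have := Rlin b (-1) x y' x y Ry' Ry; rewrite !scaleN1r addNr.
exists (fun b x => f (b, x)); split.
- by move=> b c x y; apply: Runiq (Rf _) _; apply: Rlin.
- move=> x; have [s [c [us gc /= ex ey]]] := Rf (false, x).
  have -> : f (true, x) = \sum_(p <- s | oddz p == true) c p.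
    by apply: Runiq (Rf _) _; exists s, c.
  rewrite ey [LHS]ex (bigID (fun p => oddz p == false)) /=; congr (_ + _).
  by apply: eq_bigl => p; case: (oddz p).
move=> b p x gx; apply: Runiq (Rf _) _.
exists [:: p], (fun q => if q == p then x else 0); split=> //.
- by move=> q; case: eqP => [-> // | _]; apply: gpart0.
- by rewrite big_seq1 eqxx.
- by rewrite big_mkcond big_seq1 eqxx.
Qed.

End Parity.

(** * Multilinear extension *)

Definition word_multilinear (k : fieldType) (B V : gradedSpace k)
    (f : seq (letter B) -> V) : Prop :=
  forall s1 p s2, linear (fun z : B => f (s1 ++ (p, z) :: s2)).

(** The degrees 0 and 1 stand for the even and the odd parity. *)
Definition parity_letter (k : fieldType) (B : gradedSpace k) (x : letter B) :
  letter B := ((oddz x.1 : nat)%:Z, x.2).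

Definition parity_invariant (k : fieldType) (B V : gradedSpace k)
    (f : seq (letter B) -> V) : Prop :=
  forall w, f (map (@parity_letter k B) w) = f w.

Section Extension.
Variables (k : fieldType) (B V : gradedSpace k) (e : bool -> B -> B).
Hypothesis e_lin : forall b, linear (e b).
Hypothesis e_part :
  forall b p x, gpart p x -> e b x = if oddz p == b then x else 0.
Implicit Type f : seq (letter B) -> V.

(** Multilinear extension of an operation known on homogeneous vectors, by
    splitting each vector into its even and odd parts. *)
Fixpoint extend (f : seq (letter B) -> V) (s : seq B) : V :=
  if s is x :: s' then
    extend (fun w => f ((0, e false x) :: w)) s' +
    extend (fun w => f ((1, e true x) :: w)) s'
  else f [::].

Lemma extend_combine f g h c s : (forall w, f w = c *: g w + h w) ->
  extend f s = c *: extend g s + extend h s.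
Proof.
elim: s f g h => [|x s IHs] f g h fgh /=; first exact: fgh.
rewrite (IHs (fun w => f ((0, e false x) :: w)) (fun w => g ((0, e false x) :: w))
  (fun w => h ((0, e false x) :: w)))//.
rewrite (IHs (fun w => f ((1, e true x) :: w)) (fun w => g ((1, e true x) :: w))
  (fun w => h ((1, e true x) :: w)))//.
by rewrite scalerDr addrACA.
Qed.

Lemma extend0 f s : (forall w, f w = 0) -> extend f s = 0.
Proof.
by elim: s f => [|x s IHs] f f0 //=; rewrite !IHs ?addr0 // => w; apply: f0.
Qed.

Lemma extend_multilinear f : word_multilinear f -> multilinear (extend f).
Proof.
move=> fL s1; elim: s1 f fL => [|x s1 IHs] f fL s2 c u v /=.
  rewrite !(e_lin _ c u v).
  rewrite (@extend_combine _ _ _ c _ (fun w => fL [::] 0 w c _ _)).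
  rewrite (@extend_combine _ _ _ c _ (fun w => fL [::] 1 w c _ _)).
  by rewrite scalerDr addrACA.
have fL' y : word_multilinear (fun w => f (y :: w)).
  by move=> t1; apply: (fL (y :: t1)).
rewrite (IHs _ (fL' _) s2 c u v) (IHs _ (fL' (1, _)) s2 c u v).
by rewrite scalerDr addrACA.
Qed.

Lemma extend_words f w : word_multilinear f -> parity_invariant f -> good w ->
  extend f (vectors w) = f w.
Proof.
move=> fL fP gw; rewrite -fP; clear fP; elim: w f fL gw => //= [[p x] w] IHw f fL.
case/good_cons=> /= gx gw.
have fL' y : word_multilinear (fun w => f (y :: w)).
  by move=> t1; apply: (fL (y :: t1)).
have f0 m w' : f ((m, 0) :: w') = 0.
  by have := fL [::] m w' (-1) 0 0; rewrite !scaleN1r !addNr.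
have ext0 m : extend (fun w' => f ((m, 0) :: w')) (vectors w) = 0.
  exact: extend0.
rewrite !(e_part _ gx) /parity_letter /=; case: (oddz p) => /=.
  by rewrite ext0 add0r (IHw (fun w => f ((1, x) :: w))).
by rewrite ext0 addr0 (IHw (fun w => f ((0, x) :: w))).
Qed.

End Extension.

(** * Solving the recursion on words *)

Section LinearClosure.
Variables (k : fieldType) (U V : lmodType k).
Implicit Types f g : U -> V.

Lemma eq_linear f g : (forall z, f z = g z) -> linear g -> linear f.
Proof. by move=> fg gL c u v; rewrite !fg gL. Qed.

Lemma linear_zero : linear ((fun=> 0) : U -> V).
Proof. by move=> c u v; rewrite scaler0 addr0. Qed.

Lemma linear_signed i f : linear f -> linear (fun z => signed i (f z)).
Proof. by move=> fL c u v; rewrite fL signedD; case: i; rewrite //= scalerN. Qed.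

Lemma linear_add f g : linear f -> linear g -> linear (fun z => f z + g z).
Proof. by move=> fL gL c u v; rewrite fL gL scalerDr addrACA. Qed.

Lemma linear_comp (W : lmodType k) (h : V -> W) f :
  linear h -> linear f -> linear (fun z => h (f z)).
Proof. by move=> hL fL c u v; rewrite fL hL. Qed.

Lemma linear_unshuffle_sum (T : Type) (deg : T -> int) w
    (f : seq T -> seq T -> U -> V) :
  (forall a b, linear (f a b)) ->
  linear (fun z => unshuffle_sum deg w (fun a b => f a b z)).
Proof.
elim: w f => [|x w IHw] f fL /=; first exact: fL.
apply: linear_add; apply: IHw => a b; first exact: fL.
exact: linear_signed.
Qed.

End LinearClosure.

Lemma unshuffle_sum_map (T U : Type) (dT : T -> int) (dU : U -> int) (g : T -> U)
    (V : zmodType) (F : seq U -> seq U -> V) w :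
  (forall x, oddz (dU (g x)) = oddz (dT x)) ->
  unshuffle_sum dU (map g w) F =
  unshuffle_sum dT w (fun a b => F (map g a) (map g b)).
Proof.
move=> gd; have wparE a : wpar dU (map g a) = wpar dT a.
  by elim: a => [|x a IHa]; rewrite /= ?wpar_nil // !wpar_cons gd IHa.
elim: w F => [|x w IHw] F //=; rewrite !IHw; congr (_ + _).
apply: eq_unshuffle_sum => a b _.
by rewrite /swap_sign -[[:: g x]]/(map g [:: x]) !wparE !size_map.
Qed.

Section RawOperations.
Variables (k : fieldType) (C : dgLie k) (B : cochainComplex k).
Variables (G : {linear B -> C}) (F : {linear C -> B}) (H : {linear C -> C}).
Implicit Types (f : seq (letter B) -> C) (a b w : seq (letter B)).

Local Notation sum := (unshuffle_sum (fst : letter B -> int)).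
Local Notation wd := (wdeg fst).

(** The right-hand sides of the recursion for [l_n], [u_n] and [phi_n], as
    functions of [phi] on shorter words. *)
Definition bracket_part f w : B :=
  match w with
  | [::] => 0
  | [:: x] => cdiff B x.2
  | _ => F (half_cup f w)
  end.

Definition insertion_part f w : C := - insert (bracket_part f) (leq 2) f w.

Definition morphism_step f w : C :=
  match w with
  | [::] => 0
  | [:: x] => G x.2
  | _ => H (insertion_part f w + half_cup f w)
  end.

Lemma eq_half_cup f g w : f [::] = 0 -> g [::] = 0 ->
  (forall p, (size p < size w)%N -> f p = g p) -> half_cup f w = half_cup g w.
Proof.
move=> f0 g0; case: w => [|x w] //= fg; apply: eq_unshuffle_sum => a b sp.
have := unshuffled_size sp; case: b {sp} => [|y b] sz; first by rewrite f0 g0 !bracket0r.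
by rewrite !fg //=; move: sz => /=; lia.
Qed.

Lemma eq_bracket_part f g w : f [::] = 0 -> g [::] = 0 ->
  (forall p, (size p < size w)%N -> f p = g p) ->
  bracket_part f w = bracket_part g w.
Proof.
by move=> f0 g0; case: w => [|x [|y w]] // fg; rewrite /bracket_part (eq_half_cup f0 g0 fg).
Qed.

Lemma eq_insertion_part f g w : f [::] = 0 -> g [::] = 0 ->
  (forall p, (size p < size w)%N -> f p = g p) ->
  insertion_part f w = insertion_part g w.
Proof.
move=> f0 g0 fg; congr (- _); apply: eq_unshuffle_sum => a b sp.
have sz := unshuffled_size sp; case: ifP => // a_gt1.
rewrite fg /=; last by lia.
congr (signed _ (g ((_, _) :: _))); apply: eq_bracket_part => // p lt_p.
by apply: fg; lia.
Qed.

Lemma eq_morphism_step f g w : f [::] = 0 -> g [::] = 0 ->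
  (forall p, (size p < size w)%N -> f p = g p) ->
  morphism_step f w = morphism_step g w.
Proof.
move=> f0 g0; case: w => [|x [|y w]] // fg.
by rewrite /morphism_step (eq_half_cup f0 g0 fg) (eq_insertion_part f0 g0 fg).
Qed.

Definition morphism_iter n : seq (letter B) -> C :=
  iter n morphism_step (fun=> 0).

(** The step at a word only reads shorter words, hence iterating it as many
    times as there are letters reaches its fixed point. *)
Definition raw_morphism w : C := morphism_iter (size w) w.

Lemma morphism_iter_nil n : morphism_iter n [::] = 0.
Proof. by case: n. Qed.

Lemma morphism_iter_stable n w :
  (size w <= n)%N -> morphism_iter n w = raw_morphism w.
Proof.
elim/ltn_ind: n w => -[|n] IHn w; first by case: w.
rewrite leq_eqVlt => /orP[/eqP e | lt_w]; first by rewrite /raw_morphism e.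
rewrite -(IHn n) //; case: n lt_w IHn => [|n] lt_w IHn.
  by case: w lt_w.
rewrite /morphism_iter !iterS; apply: eq_morphism_step.
- exact: (morphism_iter_nil n.+1).
- exact: morphism_iter_nil.
move=> p lt_p; have le_p : (size p <= n)%N by lia.
transitivity (raw_morphism p); last exact/esym/(IHn n (leqnSn _)).
exact: (IHn n.+1 (ltnSn _) p (leqW le_p)).
Qed.

Lemma raw_morphism_step w : raw_morphism w = morphism_step raw_morphism w.
Proof.
case: w => [|x w] //.
rewrite -[LHS]/(morphism_step (morphism_iter (size w)) (x :: w)).
apply: eq_morphism_step; [exact: morphism_iter_nil | by [] |].
by move=> p lt_p; apply: morphism_iter_stable; move: lt_p; rewrite /= ltnS.
Qed.

(** ** Multilinearity *)

Lemma linear_bracketl (U : lmodType k) (h : U -> C) (y : C) :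
  linear h -> linear (fun z => bracket (h z) y).
Proof. by move=> hL c u v; rewrite hL (bracket_linl y). Qed.

Lemma linear_bracketr (U : lmodType k) (h : U -> C) (y : C) :
  linear h -> linear (fun z => bracket y (h z)).
Proof. by move=> hL c u v; rewrite hL (bracket_linr y). Qed.

Lemma wdeg_vector a1 p (z : B) a2 :
  wd (a1 ++ (p, z) :: a2) = wd (a1 ++ (p, 0%R) :: a2).
Proof. by rewrite !wdeg_cat !wdeg_cons. Qed.

Lemma linear_sum_letter (V : lmodType k) s1 p s2
    (S : seq (letter B) -> seq (letter B) -> V) :
  (forall a1 a2 b, linear (fun z : B => S (a1 ++ (p, z) :: a2) b)) ->
  (forall a b1 b2, linear (fun z : B => S a (b1 ++ (p, z) :: b2))) ->
  linear (fun z : B => sum (s1 ++ (p, z) :: s2) S).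
Proof.
move=> Sl Sr; apply: eq_linear (fun z => unshuffle_sum_cat _ _ _ _) _.
apply: linear_unshuffle_sum => a1 b1 /=; apply: linear_add.
  apply: linear_unshuffle_sum => a2 b2.
  apply: (eq_linear (g := fun z => signed (swap_sign fst b1 ((p, 0%R) :: a2))
      (S (a1 ++ (p, z) :: a2) (b1 ++ b2)))) => [z|].
    by rewrite /swap_sign !wpar_cons.
  exact: linear_signed.
apply: linear_unshuffle_sum => a2 b2.
apply: (eq_linear (g := fun z => signed (swap_sign fst [:: (p, 0%R : B)] a2)
    (signed (swap_sign fst b1 a2) (S (a1 ++ a2) (b1 ++ (p, z) :: b2))))) => [z|].
  by rewrite /swap_sign !wpar_cons.
by do 2!apply: linear_signed.
Qed.

Lemma linear_kap (V : lmodType k) (h : B -> V) a1 p a2 b :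
  linear h -> linear (fun z => signed (kap (a1 ++ (p, z) :: a2) b) (h z)).
Proof.
move=> hL; apply: (eq_linear
  (g := fun z => signed (kap (a1 ++ (p, 0%R) :: a2) b) (h z))) => [z|].
  by rewrite /kap /wpar wdeg_vector !size_cat.
exact: linear_signed.
Qed.

Lemma half_cup_multilinear f : word_multilinear f -> word_multilinear (half_cup f).
Proof.
move=> fL [|x s1] p s2 /=.
  apply: linear_unshuffle_sum => a b; apply: (linear_kap [::]).
  by apply: linear_bracketl; apply: (fL [::]).
apply: linear_sum_letter => [a1 a2 b | a b1 b2].
  by apply: (linear_kap (x :: a1)); apply: linear_bracketl; apply: (fL (x :: a1)).
apply: (eq_linear (g := fun z => signed (kap (x :: a) (b1 ++ (p, 0%R) :: b2))
   (bracket (f (x :: a)) (f (b1 ++ (p, z) :: b2))))) => [z|].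
  by rewrite /kap !size_cat.
by apply: linear_signed; apply: linear_bracketr; apply: fL.
Qed.

Lemma bracket_part_multilinear f :
  word_multilinear f -> word_multilinear (bracket_part f).
Proof.
move=> fL s1 p s2; have hL := half_cup_multilinear fL s1 p s2.
have FhL : linear (fun z : B => F (half_cup f (s1 ++ (p, z) :: s2))).
  by apply: linear_comp hL => c u v; apply: linearP.
case: s1 s2 FhL {hL} => [|x [|y s1]] [|t s2] //= _ c u v.
exact: linearP.
Qed.

Lemma insertion_part_multilinear f :
  word_multilinear f -> word_multilinear (insertion_part f).
Proof.
move=> fL s1 p s2; apply: (linear_signed true).
have lL := bracket_part_multilinear fL.
apply: linear_sum_letter => [a1 a2 b | a b1 b2].
  apply: (eq_linear (g := fun z : B => if (1 < size (a1 ++ (p, 0%R : B) :: a2))%N then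
    signed (odd (size (a1 ++ (p, 0%R : B) :: a2)) && odd (size b))
      (f ((wd (a1 ++ (p, 0%R) :: a2) + 2 - (size (a1 ++ (p, 0%R : B) :: a2))%:Z,
           bracket_part f (a1 ++ (p, z) :: a2)) :: b)) else 0 : C)) => [z|].
    by rewrite /out wdeg_vector !size_cat.
  case: (1 < size (a1 ++ _))%N; last exact: linear_zero.
  apply: linear_signed.
  apply: (linear_comp (h := fun z => f ((_, z) :: b))); last exact: lL.
  exact: (fL [::]).
apply: (eq_linear (g := fun z : B => if (1 < size a)%N then
  signed (odd (size a) && odd (size (b1 ++ (p, 0%R : B) :: b2)))
    (f (out (bracket_part f) a :: b1 ++ (p, z) :: b2)) else 0)) => [z|].
  by rewrite !size_cat.
case: (1 < size a)%N; last exact: linear_zero.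
by apply: linear_signed; apply: (fL (_ :: b1)).
Qed.

Lemma morphism_step_multilinear f :
  word_multilinear f -> word_multilinear (morphism_step f).
Proof.
move=> fL s1 p s2.
have HhL : linear (fun z : B => H (insertion_part f (s1 ++ (p, z) :: s2) +
    half_cup f (s1 ++ (p, z) :: s2))).
  apply: linear_comp => [c u v|]; first exact: linearP.
  by apply: linear_add; [apply: insertion_part_multilinear
                        | apply: half_cup_multilinear].
case: s1 s2 HhL => [|x [|y s1]] [|t s2] //= _ c u v.
exact: linearP.
Qed.

Lemma raw_morphism_multilinear : word_multilinear raw_morphism.
Proof.
have iterL n : word_multilinear (morphism_iter n).
  elim: n => [|n IHn]; first by move=> s1 p s2; apply: linear_zero.
  exact: morphism_step_multilinear.
move=> s1 p s2; apply: eq_linear (iterL (size s1 + (size s2).+1)%N s1 p s2) => z.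
by rewrite morphism_iter_stable // size_cat.
Qed.

(** ** Independence of the representatives of the parities *)

Lemma oddz_parity (x : letter B) : oddz (parity_letter x).1 = oddz x.1.
Proof. by rewrite /parity_letter /=; case: (oddz x.1). Qed.

Lemma parity_out f a : parity_invariant (bracket_part f) ->
  parity_letter (out (bracket_part f) (map (@parity_letter k B) a)) =
  parity_letter (out (bracket_part f) a).
Proof.
move=> inv; set a' := map _ a.
have par_a : wpar fst a' = wpar fst a.
  rewrite /a'; elim: a {a'} => [|x a IHa] //=.
  by rewrite !wpar_cons IHa oddz_parity.
by rewrite /parity_letter !oddz_out /= par_a size_map inv.
Qed.

Lemma half_cup_parity f : parity_invariant f -> parity_invariant (half_cup f).
Proof.
move=> inv [|x w] //=; rewrite (unshuffle_sum_map _ _ oddz_parity).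
apply: eq_unshuffle_sum => a b _.
rewrite -map_cons !inv /kap !size_map; congr (signed (_ (+) (_ && _)) _).
elim: (x :: a) => [|y c IHc] //=; rewrite !wpar_cons IHc.
by rewrite oddz_parity.
Qed.

Lemma bracket_part_parity f :
  parity_invariant f -> parity_invariant (bracket_part f).
Proof.
move=> inv w; have hi := half_cup_parity inv w.
by case: w hi => [|x [|y w]] // hi; exact: (congr1 F hi).
Qed.

Lemma insertion_part_parity f :
  parity_invariant f -> parity_invariant (insertion_part f).
Proof.
move=> inv w; congr (- _); rewrite /insert (unshuffle_sum_map _ _ oddz_parity).
apply: eq_unshuffle_sum => a b _; rewrite !size_map; case: ifP => // _.
rewrite -inv -[in RHS]inv /= parity_out; last exact: bracket_part_parity.
by rewrite -!map_comp; congr (signed _ (f (_ :: _))); apply: eq_map => x /=;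
  rewrite /parity_letter /= oddz_parity.
Qed.

Lemma raw_morphism_parity : parity_invariant raw_morphism.
Proof.
have iterP n : parity_invariant (morphism_iter n).
  elim: n => [|n IHn] // w; rewrite /morphism_iter iterS -/(morphism_iter n).
  have hi := half_cup_parity IHn w; have ii := insertion_part_parity IHn w.
  by case: w hi ii => [|x [|y w]] // hi ii; exact: (congr1 H (congr2 +%R ii hi)).
by move=> w; rewrite /raw_morphism iterP size_map.
Qed.

(** ** Degrees *)

Hypothesis G_deg : map_degree 0 G.
Hypothesis F_deg : map_degree 0 F.
Hypothesis H_deg : map_degree (-1) H.

Definition word_degree (V : gradedSpace k) (m : int) (f : seq (letter B) -> V) :=
  forall w, good w -> gpart (wd w + m - (size w)%:Z) (f w).

Lemma gpart_unshuffle_sum (V : gradedSpace k) q w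
    (S : seq (letter B) -> seq (letter B) -> V) :
  (forall a b, unshuffled w a b -> gpart q (S a b)) -> gpart q (sum w S).
Proof.
elim: w S => [|x w IHw] S gS /=; first exact: gS.
apply: gpartD; apply: IHw => a b sp; last apply: gpart_signed; apply: gS.
  by left; exists a.
by right; exists b.
Qed.

Lemma half_cup_degree f : word_degree 1 f -> word_degree 2 (half_cup f).
Proof.
move=> fd [|x w] gw; first exact: gpart0.
apply: gpart_unshuffle_sum => a b sp; apply: gpart_signed.
have [gx /(good_unshuffled sp)[ga gb]] := (good_cons x w).1 gw.
have gxa : good (x :: a) by apply/good_cons.
have -> : wd (x :: w) + 2 - (size (x :: w))%:Z =
    (wd (x :: a) + 1 - (size (x :: a))%:Z) + (wd b + 1 - (size b)%:Z).
  rewrite !wdeg_cons (unshuffled_wdeg _ sp) /= (unshuffled_size sp).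
  by move: (wd a) (wd b) => da db; lia.
by apply: bracket_deg; apply: fd.
Qed.

Lemma bracket_part_degree f : word_degree 1 f -> word_degree 2 (bracket_part f).
Proof.
move=> fd w gw; have := half_cup_degree fd gw.
case: w gw => [|x [|y w]] gw hd; first exact: gpart0.
  have [gx _] := (good_cons x [::]).1 gw.
  rewrite wdeg_cons /wdeg big_nil addr0 -addrA.
  exact: (@cdiff_deg _ B _ _ gx).
by rewrite -[wd _ + _ - _]addr0; apply: F_deg.
Qed.

Lemma insertion_part_degree f :
  word_degree 1 f -> word_degree 2 (insertion_part f).
Proof.
move=> fd w gw; apply: (gpart_signed true); apply: gpart_unshuffle_sum => a b sp.
case: ifP => _; last exact: gpart0.
have [ga gb] := good_unshuffled sp gw; apply: gpart_signed.
have gab : good (out (bracket_part f) a :: b).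
  by apply/good_cons; split=> //; apply: bracket_part_degree.
have := fd _ gab; rewrite wdeg_cons /= (unshuffled_wdeg _ sp) (unshuffled_size sp).
congr gpart; move: (wd a) (wd b) => da db; lia.
Qed.

Lemma raw_morphism_degree : word_degree 1 raw_morphism.
Proof.
have iterd n : word_degree 1 (morphism_iter n).
  elim: n => [|n IHn] w gw; first exact: gpart0.
  have := gpartD (insertion_part_degree IHn gw) (half_cup_degree IHn gw).
  rewrite /morphism_iter iterS -/(morphism_iter n).
  case: w gw => [|x [|y w]] gw hd; first exact: gpart0.
    have [gx _] := (good_cons x [::]).1 gw.
    rewrite wdeg_cons /wdeg big_nil addr0 addrK /= -[x.1]addr0.
    exact: G_deg.
  have := H_deg hd; congr gpart; move: (wd _) => da; lia.
by move=> w gw; apply: iterd.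
Qed.

End RawOperations.

(** * Existence and the transfer theorem *)

Section Existence.
Variables (k : fieldType) (C : dgLie k) (B : cochainComplex k).
Variables (G : {linear B -> C}) (F : {linear C -> B}) (H : {linear C -> C}).
Hypothesis G_deg : map_degree 0 G.
Hypothesis F_deg : map_degree 0 F.
Hypothesis H_deg : map_degree (-1) H.

(** The extensions of the operations on words satisfy the recursion because they
    coincide with these operations on homogeneous vectors. *)
Lemma transfer_exists :
  exists (l : seq B -> B) (u v phi : seq B -> C), is_transfer F G H l u v phi.
Proof.
have [e [e_lin e_sum e_part]] := parity_projections B.
pose Phi : seq (letter B) -> C := raw_morphism G F H.
pose lam := bracket_part F Phi.
have PhiL : word_multilinear Phi by exact: raw_morphism_multilinear.
have PhiP : parity_invariant Phi by exact: raw_morphism_parity.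
have Phid : word_degree 1 Phi by exact: raw_morphism_degree.
have [lamL lamP] := (bracket_part_multilinear F PhiL, bracket_part_parity F PhiP).
have [uL uP] := (insertion_part_multilinear F PhiL, insertion_part_parity F PhiP).
have [vL vP] := (half_cup_multilinear PhiL, half_cup_parity PhiP).
have ext_degree (V : gradedSpace k) m (f : seq (letter B) -> V) :
    word_multilinear f -> parity_invariant f -> word_degree m f ->
    op_degree (fun n => m - n%:Z) (extend e f).
  move=> fL fP fd n d x n_gt0 /homogeneousP[y [gy -> ->]].
  rewrite -wdeg_tuple addrA extend_words //.
  by have := fd y gy; rewrite size_tuple.
have on_wordsP (V : gradedSpace k) (f : seq (letter B) -> V) w :
    word_multilinear f -> parity_invariant f -> f [::] = 0 -> good w ->
    on_words (extend e f) w = f w.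
  by move=> fL fP f0 gw; case: w gw => // x w gw; apply: extend_words.
exists (extend e lam), (extend e (insertion_part F Phi)),
  (extend e (half_cup Phi)), (extend e Phi).
split.
- by split; apply: extend_multilinear.
- split; apply: ext_degree => //.
  + exact: bracket_part_degree.
  + exact: insertion_part_degree.
  + exact: half_cup_degree.
- move=> x; have u1 y : insertion_part F Phi [:: y] = 0.
    by rewrite /insertion_part /insert /= signed0 addr0 oppr0.
  split=> /=; rewrite ?u1 ?bracket0r ?signed0 ?addr0 //.
    by rewrite /lam /= -(lin_morphD (cdiff B)) -e_sum.
  by rewrite /Phi /raw_morphism /= -(lin_morphD G) -e_sum.
move=> n d x n_gt1 /homogeneousP[y [gy -> ->]]; have n_gt0 := ltnW n_gt1.
have y_gt1 : (1 < size y)%N by rewrite size_tuple.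
rewrite sum_bracket_op // (@sum_insert_op _ _ _ _ _ 2 1) // !extend_words //.
have -> : half_cup (on_words (extend e Phi)) y = half_cup Phi y.
  case: (tval y) gy => [|z w] // /good_cons[gz gw].
  apply: eq_unshuffle_sum => a b sp; have [ga gb] := good_unshuffled sp gw.
  have gza : good (z :: a) by apply/good_cons.
  by rewrite (on_wordsP _ _ b) // (on_wordsP _ _ (z :: a)).
have -> : insert (on_words (extend e lam)) (leq 2) (on_words (extend e Phi)) y =
    insert lam (leq 2) Phi y.
  apply: eq_unshuffle_sum => a b sp; have [ga gb] := good_unshuffled sp gy.
  case: ifP => // _; rewrite /out (on_wordsP _ lam) // on_wordsP //.
  by apply/good_cons; split=> //; apply: bracket_part_degree.
split=> //.
  by rewrite /lam; case: (tval y) y_gt1 => [|z [|z' w]].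
rewrite {1}/Phi raw_morphism_step -/Phi.
by case: (tval y) y_gt1 => [|z [|z' w]].
Qed.

End Existence.

Theorem theorem2p7 (k : fieldType) (k_char0 : [pchar k] =i pred0)
    (C : dgLie k) (B : cochainComplex k)
    (G : {linear B -> C}) (F : {linear C -> B}) (H : {linear C -> C})
    (G_deg : map_degree 0 G) (F_deg : map_degree 0 F)
    (H_deg : map_degree (-1) H)
    (G_diff : forall x, G (cdiff B x) = cdiff C (G x))
    (F_diff : forall y, F (cdiff C y) = cdiff B (F y))
    (FG_id : forall x, F (G x) = x)
    (GF_homotopy : forall y, G (F y) - y = H (cdiff C y) + cdiff C (H y))
    (FH_0 : forall y, F (H y) = 0) :
  (exists (l : seq B -> B) (u v phi : seq B -> C),
     is_transfer F G H l u v phi) /\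
  (forall (l : seq B -> B) (u v phi : seq B -> C),
     is_transfer F G H l u v phi ->
     [/\ is_Linfty l, is_weak_morphism l phi &
         forall x : B, phi [:: x] = G x]).
Proof.
split; first exact: transfer_exists.
move=> l u v phi T.
have [isL isM] := transfer_Linfty_morphism k_char0 F_diff G_diff FG_id
  GF_homotopy FH_0 T.
by split=> // x; have [] := transfer_1 T x.
Qed.
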